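(* Let $\Omega\subset\mathbb{R}^n$ be measurable with $0$ an interior point, and let $f,S:\Omega\to\mathbb{R}$ be measurable functions satisfying: (1) for each $\epsilon>0$, $S$ is bounded below by a positive constant on $\Omega\setminus B_\epsilon(0)$; (2) there are $\nu>0$ and a positive continuous $S_0:S^{n-1}\to\mathbb{R}$ with $S(x)=\rho^\nu S_0(\xi)+o(\rho^\nu)$ as $\rho\to0$, uniformly in $\xi\in S^{n-1}$; (3) there are $\lambda>0$ and a bounded measurable $f_0:S^{n-1}\to\mathbb{R}$ with $f(x)=\rho^{\lambda-n}f_0(\xi)+o(\rho^{\lambda-n})$ as $\rho\to0$, uniformly in $\xi\in S^{n-1}$; (4) there is $\sigma_0>0$ with $\int_\Omega e^{-\sigma_0S(x)}|f(x)|\,dx<\infty$. Extend $f_0,S_0$ to $\mathbb{R}^n$ by $f_0(x)=\rho^{\lambda-n}f_0(\xi)$, $S_0(x)=\rho^\nu S_0(\xi)$ for $x\ne0$ and $f_0(0)=S_0(0)=0$. Then for each $0<\delta\le\frac{\pi}{2}$, \[ \int_\Omega e^{-zS(x)}f(x)\,dx=z^{-\lambda/\nu}\int_{\mathbb{R}^n}e^{-S_0(x)}f_0(x)\,dx+o(z^{-\lambda/\nu})\qquad(z\to\infty,\ |\arg z|\le\tfrac{\pi}{2}-\delta), \] and \[ \int_{\mathbb{R}^n}e^{-S_0(x)}f_0(x)\,dx=\frac{\Gamma(\lambda/\nu)}{\nu}\int_{S^{n-1}}\frac{f_0(\xi)}{S_0(\xi)^{\lambda/\nu}}\,d\omega(\xi),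 \] where $\omega$ is surface measure on $S^{n-1}$.
   Context: Points $x\in\mathbb{R}^n\setminus\{0\}$ are written in spherical coordinates $x=\rho\xi$ with $\rho=|x|$ (Euclidean norm) and $\xi=x/\rho\in S^{n-1}$; $B_\epsilon(0)$ is the open Euclidean ball of radius $\epsilon$. The power $z^{-\lambda/\nu}$ is the principal branch. The relation ''$=\ldots+o(z^{-\lambda/\nu})$ as $z\to\infty$, $|\arg z|\le\frac\pi2-\delta$'' is meant uniformly: for every $\eta>0$ there is $R$ such that the error is at most $\eta|z|^{-\lambda/\nu}$ for all $|z|\ge R$ with $|\arg z|\le\frac{\pi}{2}-\delta$. *)

(* Defs.v *)
From HB Require Import structures.
From mathcomp Require Import all_boot all_order all_algebra.
From mathcomp Require Import all_classical all_reals all_analysis.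
From mathcomp Require Import complex.

Set Implicit Arguments.
Unset Strict Implicit.
Unset Printing Implicit Defensive.
Import Order.TTheory GRing.Theory Num.Theory.
Import numFieldNormedType.Exports ComplexField.Normc.

Local Open Scope classical_set_scope.
Local Open Scope ring_scope.

(* Euclidean space is 'rV[R]_n.+1, of dimension n.+1 >= 1, with the library
   topology on row vectors. *)

Section euclidean.
Variables (R : realType) (n : nat).
Local Notation V := 'rV[R]_n.+1.

(* The library norm of a row vector is the sup norm. *)
Definition enorm (x : V) : R := Num.sqrt (\sum_i x 0 i ^+ 2).

Definition eball (eps : R) : set V := [set x | enorm x < eps].

Lemma enorm_delta : enorm (delta_mx 0 0) = 1.
Proof.
rewrite /enorm (bigD1 ord0)//= big1 => [|i i0]; rewrite mxE/=.
  by rewrite expr1n addr0 sqrtr1.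
by rewrite (negbTE i0) expr0n.
Qed.

Lemma enorm_ge0 (x : V) : 0 <= enorm x. Proof. exact: sqrtr_ge0. Qed.

Lemma enormZ (r : R) (x : V) : enorm (r *: x) = `|r| * enorm x.
Proof.
rewrite /enorm -sqrtr_sqr -sqrtrM ?sqr_ge0// mulr_sumr; congr Num.sqrt.
by apply: eq_bigr => i _; rewrite mxE exprMn.
Qed.

Lemma enorm_eq0 (x : V) : enorm x = 0 -> x = 0.
Proof.
move=> /eqP; rewrite sqrtr_eq0 => xle0; apply/rowP => i; rewrite mxE.
have xge0 j : true -> 0 <= x 0 j ^+ 2 by rewrite sqr_ge0.
have /eqP : \sum_j x 0 j ^+ 2 = 0 by apply: le_anti; rewrite xle0 sumr_ge0.
rewrite psumr_eq0// => /allP/(_ i).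
by rewrite mem_index_enum sqrf_eq0 => /(_ isT)/eqP.
Qed.

Lemma enorm_normalize (x : V) : x != 0 -> enorm ((enorm x)^-1 *: x) = 1.
Proof.
move=> x0; rewrite enormZ ger0_norm ?invr_ge0 ?enorm_ge0// mulVf//.
by apply: contra x0 => /eqP/enorm_eq0 ->.
Qed.

Definition usphere : set V := [set x | enorm x = 1].

Definition sphere : Type := set_type usphere.

HB.instance Definition _ := Choice.on sphere.
HB.instance Definition _ := Topological.copy sphere (set_type usphere).

Definition sphere_pt : sphere := exist _ (delta_mx 0 0) (mem_set enorm_delta).

HB.instance Definition _ := isPointed.Build sphere sphere_pt.

(* x |-> x / |x|, with an arbitrary value at 0. *)
Definition dir (x : V) : sphere := insubd sphere_pt ((enorm x)^-1 *: x).

Lemma val_dir (x : V) : x != 0 -> \val (dir x) = (enorm x)^-1 *: x.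
Proof.
move=> x0; rewrite insubdK//; apply/mem_set.
exact: enorm_normalize.
Qed.

End euclidean.
Arguments eball {R n} eps _.
Arguments dir {R n} x.

Section lebesgue.
Variables (R : realType) (n : nat).
Local Notation V := 'rV[R]_n.+1.
Local Open Scope ereal_scope.

Definition box (b : V * V) : set V :=
  [set x | forall i, (b.1 ord0 i <= x ord0 i < b.2 ord0 i)%R].

Definition box_vol (b : V * V) : R :=
  (\prod_i Num.max 0 (b.2 ord0 i - b.1 ord0 i))%R.

Definition box_cover (A : set V) : set (nat -> V * V) :=
  [set b | A `<=` \bigcup_k box (b k)].

Definition lebesgue_outer (A : set V) : \bar R :=
  ereal_inf [set \sum_(k <oo) (box_vol (b k))%:E | b in box_cover A].

Let box_vol_ge0 b : 0 <= (box_vol b)%:E.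
Proof. by rewrite lee_fin prodr_ge0// => i _; rewrite le_max lexx. Qed.

Let lebesgue_outer_ge0 A : 0 <= lebesgue_outer A.
Proof. by apply: le_ereal_inf_tmp => _ [b _ <-]; exact: nneseries_ge0. Qed.

Let le_lebesgue_outer : {homo lebesgue_outer : A B / A `<=` B >-> A <= B}.
Proof.
move=> A B AB; apply/ereal_inf_le_tmp => _ [b Bb <-]; exists b => //.
exact: subset_trans AB Bb.
Qed.

Let lebesgue_outer0 : lebesgue_outer set0 = 0.
Proof.
apply/eqP; rewrite eq_le lebesgue_outer_ge0 andbT.
apply: ereal_inf_lbound; exists (fun=> (0, 0)%R) => //.
apply: eseries0 => k _ _; rewrite /box_vol big_ord_recl/= !mxE subr0 maxxx.
by rewrite mul0r.
Qed.

Let lebesgue_outer_sigma_subadditive : sigma_subadditive lebesgue_outer.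
Proof.
move=> A; have [[i ioo]|] := pselect (exists i, lebesgue_outer (A i) = +oo).
  rewrite (eseries_pinfty _ _ ioo) ?leey// => k _.
  by rewrite -ltNye (lt_le_trans _ (lebesgue_outer_ge0 _)).
rewrite -forallNE => Aoo.
suff add2e (e : {posnum R}) : lebesgue_outer (\bigcup_n A n) <=
    \sum_(i <oo) lebesgue_outer (A i) + e%:num%:E.
  by apply/lee_addgt0Pr => _/posnumP[].
rewrite (le_trans _ (epsilon_trick _ _ _))//.
pose P k (b : nat -> V * V) := box_cover (A k) b /\
  \sum_(j <oo) (box_vol (b j))%:E <=
  lebesgue_outer (A k) + (e%:num / (2 ^ k.+1)%:R)%:E.
have [G PG] : {G : nat -> nat -> V * V & forall k, P k (G k)}.
  apply: (@choice _ _ P) => k; rewrite /P /lebesgue_outer.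
  set S := (X in ereal_inf X); move infS : (ereal_inf S) => iS.
  case: iS infS => [r Sr|Soo|Soo].
  - have en1 : (0 < e%:num / (2 ^ k.+1)%:R)%R by [].
    have /(lb_ereal_inf_adherent en1) : ereal_inf S \is a fin_num by rewrite Sr.
    move=> [x [B AnB muBx] xS].
    by exists B; split => //; rewrite muBx -Sr; exact/ltW.
  - by have := Aoo k; rewrite /lebesgue_outer Soo.
  - suff : lbound S 0 by move/le_ereal_inf_tmp; rewrite Soo.
    by move=> /= _ [B AnB <-]; exact: nneseries_ge0.
pose m b := (box_vol b)%:E.
have mG_ge0 x : 0 <= (m \o uncurry G) x by exact: box_vol_ge0.
apply: (@le_trans _ _ (\esum_(i in setT) (m \o uncurry G) i)).
  apply: ereal_inf_lbound => /=.
  have /card_esym/ppcard_eqP[h] := card_nat2.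
  exists (uncurry G \o h).
    move=> t [i _] /((PG i).1) [j _ Bijt]; exists (h^-1%FUN (i, j)) => //.
    by rewrite /= invK ?inE.
  rewrite -(esum_pred_image (m \o uncurry G) _ xpredT) ?[fun=> _]set_true//.
  by rewrite image_eq.
rewrite (_ : esum _ _ = \sum_(i <oo) \sum_(j <oo ) m (G i j)); last first.
  pose J : nat -> set (nat * nat) := fun i => [set (i, j) | j in setT].
  rewrite (_ : setT = \bigcup_k J k); last first.
    by rewrite predeqE => -[a b]; split => // _; exists a => //; exists b.
  rewrite esum_bigcupT /=; last 2 first.
    - apply/trivIsetP => i j _ _ ij.
      rewrite predeqE => -[k l] /=; split => //= -[] [_] _ [<-{k} _].
      by move=> [l' _] []/= /esym/eqP; rewrite (negbTE ij).
    - by move=> /= [k l]; exact: box_vol_ge0.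
  rewrite -(image_id [set: nat]) -fun_true esum_pred_image//; last first.
    by move=> k _; apply: esum_ge0 => x _; exact: mG_ge0.
  apply: eq_eseriesr => /= j _.
  rewrite -(esum_pred_image (m \o uncurry G) (pair j) predT)/=; last 2 first.
  - by move=> l _; exact: box_vol_ge0.
  - by move=> ? ? _ _; exact: (@can_inj _ _ _ snd).
  by congr esum; rewrite predeqE => -[a b]; split; move=> [i _ <-]; exists i.
apply: lee_lim.
- apply: is_cvg_nneseries => k *.
  by apply: nneseries_ge0 => l *; exact: box_vol_ge0.
- by apply: is_cvg_nneseries => k *; exact: adde_ge0.
- by near=> k; apply: lee_sum => i _; exact: (PG i).2.
Unshelve. all: by end_near. Qed.

HB.instance Definition _ := isOuterMeasure.Build R V lebesgue_outer
  lebesgue_outer0 lebesgue_outer_ge0 le_lebesgue_outer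
  lebesgue_outer_sigma_subadditive.

(* Measurable sets of row vectors are the Lebesgue (Caratheodory) measurable
   ones, not only the Borel sets. *)
HB.instance Definition _ :=
  Measurable.copy V (caratheodory_type lebesgue_outer).

Definition lebesgue_n : set V -> \bar R := lebesgue_outer.

HB.instance Definition _ := isMeasure.Build _ V R lebesgue_n
  (@caratheodory_measure0 R V lebesgue_outer)
  (@caratheodory_measure_ge0 R V lebesgue_outer)
  (@caratheodory_measure_sigma_additive R V lebesgue_outer).

End lebesgue.
Arguments lebesgue_outer {R n} A.
Arguments lebesgue_n {R n} _.

Section surface_measure.
Variables (R : realType) (n : nat).
Local Notation V := 'rV[R]_n.+1.
Local Notation sphere := (sphere R n).
Local Open Scope ereal_scope.

Definition sphere_display : measure_display. Proof. exact. Qed.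

(* A set of directions is measurable when the infinite cone over it is Lebesgue
   measurable: this is the completion of the Borel sets of the sphere. *)
Definition sphere_measurable : set (set sphere) :=
  [set E | measurable (dir @^-1` E)].

Let sphere_measurable0 : sphere_measurable set0.
Proof. by rewrite /sphere_measurable/= preimage_set0. Qed.

Let sphere_measurableC E : sphere_measurable E -> sphere_measurable (~` E).
Proof.
by move=> mE; rewrite /sphere_measurable/= preimage_setC; exact: measurableC.
Qed.

Let sphere_measurable_bigcup (F : (set sphere)^nat) :
  (forall i, sphere_measurable (F i)) -> sphere_measurable (\bigcup_i F i).
Proof.
move=> mF; rewrite /sphere_measurable/= preimage_bigcup.
exact: bigcupT_measurable.
Qed.

HB.instance Definition _ := @isMeasurable.Build sphere_display sphere
  sphere_measurable sphere_measurable0 sphere_measurableC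
  sphere_measurable_bigcup.

(* The volume of {x | 0 < |x| < 1, x / |x| \in E}, up to the null set {0}. *)
Definition cone_volume (E : set sphere) : \bar R :=
  lebesgue_n (eball 1 `&` dir @^-1` E).

Let cone_volume0 : cone_volume set0 = 0.
Proof. by rewrite /cone_volume preimage_set0 setI0 measure0. Qed.

Let cone_volume_ge0 E : 0 <= cone_volume E.
Proof. exact: measure_ge0. Qed.

Let cone_volume_sigma_additive : semi_sigma_additive cone_volume.
Proof.
move=> F mF tF _; rewrite /cone_volume preimage_bigcup.
pose A k : set V := dir @^-1` F k; pose X := eball 1 : set V.
have tA : trivIset setT A.
  by apply/trivIsetP => i j _ _ ij; rewrite -preimage_setI;
    move/trivIsetP : tF => /(_ i j I I ij) ->; rewrite preimage_set0.
have mA k : lebesgue_outer.-caratheodory (A k) := mF k.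
suff -> : lebesgue_n (X `&` \bigcup_k A k) =
    \sum_(k <oo) lebesgue_outer (X `&` A k).
  by apply: is_cvg_nneseries => k _ _; exact: (outer_measure_ge0 lebesgue_outer).
apply/eqP; rewrite eq_le (outer_measure_bigcup_lim lebesgue_outer)/=.
have := caratheodory_lime_le mA tA (X `&` \bigcup_k A k).
rewrite -setIA setICr setI0 outer_measure0 adde0.
congr (_ <= _); apply: eq_eseriesr => k _; rewrite -setIA.
by congr (lebesgue_outer (_ `&` _)); apply/setIidPr; exact: bigcup_sup.
Qed.

HB.instance Definition _ := isMeasure.Build _ sphere R cone_volume
  cone_volume0 cone_volume_ge0 cone_volume_sigma_additive.

(* Surface measure on the unit sphere, as defined in measure theory
   textbooks (Folland, Stein-Shakarchi): the dimension times the volume of the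
   cone over the given set. *)
Definition surface_measure : {measure set sphere -> \bar R} :=
  mscale (n.+1%:R%:nng)%R cone_volume.

End surface_measure.
Arguments surface_measure {R n}.

(* A function on the sphere, extended to the whole space as a homogeneous
   function of degree a, with value 0 at 0. *)
Definition homogeneous_ext (R : realType) (n : nat) (a : R)
    (g : sphere R n -> R) (x : 'rV[R]_n.+1) : R :=
  if x == 0 then 0 else enorm x `^ a * g (dir x).

(* g(rho xi) = rho^a h(xi) + o(rho^a) as rho -> 0, uniformly in xi. *)
Definition asymp_at0 (R : realType) (n : nat) (D : set 'rV[R]_n.+1)
    (g : 'rV[R]_n.+1 -> R) (a : R) (h : sphere R n -> R) : Prop :=
  forall eta : R, 0 < eta -> \forall rho \near 0^'+, forall xi : sphere R n,
    D (rho *: val xi) ->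
    `|g (rho *: val xi) - rho `^ a * h xi| <= eta * rho `^ a.

Section complex_functions.
Variable R : realType.
Local Open Scope complex_scope.
Implicit Types z w : R[i].

Definition cexp z : R[i] :=
  (expR (complex.Re z) * cos (complex.Im z)) +i*
  (expR (complex.Re z) * sin (complex.Im z)).

(* The principal argument, in ]-pi, pi], for z != 0. *)
Definition carg z : R :=
  let theta := acos (complex.Re z / normc z) in
  if 0 <= complex.Im z then theta else - theta.

Definition clog z : R[i] := ln (normc z) +i* carg z.

Definition cpow z w : R[i] := cexp (w * clog z).

Definition Gamma (a : R) : R :=
  \int[lebesgue_measure]_(t in `]0, +oo[) (t `^ (a - 1) * expR (- t)).

Variables (d : measure_display) (T : measurableType d).
Variable mu : {measure set T -> \bar R}.

Definition cintegrable (D : set T) (g : T -> R[i]) : Prop :=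
  mu.-integrable D (EFin \o (fun x => complex.Re (g x))) /\
  mu.-integrable D (EFin \o (fun x => complex.Im (g x))).

Definition cintegral (D : set T) (g : T -> R[i]) : R[i] :=
  (\int[mu]_(x in D) complex.Re (g x)) +i*
  (\int[mu]_(x in D) complex.Im (g x)).

End complex_functions.

(* Main.v *)
(** The image of Lebesgue measure under x |-> (|x|^n, x/|x|) is Lebesgue measure
    on (0, +oo) times the cone volume, because both sides scale alike under
    dilations. After a power substitution this gives, for phi integrable against
    t^(lambda/nu - 1),
      int phi(S0) f0 = 1/nu int_0^oo phi(t) t^(lambda/nu - 1) dt
                       * int_sphere f0 / S0^(lambda/nu).
    For phi(t) = exp(-t) this is the formula for the constant. For
    phi(t) = exp(-zt) with z = Z e^(i th) the radial integral is
    Gamma(a) z^(-a), a = lambda/nu, because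
    int_0^oo e^(i a th) exp(-Z e^(i th) t) t^(a-1) dt does not depend on th: the
    th-derivative of the integrand is a total t-derivative.
    Near 0, replacing (S, f) by (S0, f0) costs at most eta times
    int exp(-beta Z rho^nu) (1 + C Z rho^nu) rho^(lambda-n), which by homogeneity
    is a multiple of Z^(-a); away from 0 both integrals are exponentially small.
    Real and imaginary parts are treated separately, as integrals of
    exp(-p S) c(q S) f with z = p + iq and c = cos or sin. *)
From HB Require Import structures.
Require Import Defs.
From mathcomp Require Import all_boot all_order all_algebra.
From mathcomp Require Import all_classical all_reals all_analysis.
From mathcomp Require Import measurable_realfun.
From mathcomp Require Import complex.
From mathcomp Require Import ring lra.
Import Order.TTheory GRing.Theory Num.Theory.
Import numFieldNormedType.Exports ComplexField.Normc.
Local Open Scope classical_set_scope.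
Local Open Scope ring_scope.
Local Open Scope complex_scope.

(** * Lebesgue measure and the Euclidean norm *)

(** Measurable sets of space are the Caratheodory sets of an outer measure built from boxes, and
    those of the sphere are defined through cones. Measurability of half-spaces, the scaling law and
    the polar formula therefore all go back to covers by boxes, and even a continuous function on
    the sphere has to be shown measurable.

    The polar formula rests on Tonelli's theorem and so concerns nonnegative integrands, whereas
    exp(-pt) cos(qt) and f0 change sign; both factors are written as differences of nonnegative
    functions.

    The lower bound on S says nothing of S(0), which may be negative, so exp(-pS) is not controlled
    at the origin. The estimates suppose f(0) = 0, and the origin, a null set, is dealt with at the
    end.

    The sector enters only through Re z >= ka |z| with ka = cos(pi/2 - delta) > 0. All bounds are in
    terms of ka and |z|, which makes the threshold independent of arg z. *)

Section euclidean_space.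
Context {R : realType} {n : nat}.
Local Notation V := 'rV[R]_n.+1.
Implicit Types (x : V) (A X : set V) (r : R).

Lemma box_vol_ge0 (b : V * V) : 0 <= box_vol b.
Proof. by rewrite prodr_ge0// => i _; rewrite le_max lexx. Qed.

Lemma lebesgue_outer_cover A (b : nat -> V * V) : A `<=` \bigcup_k box (b k) ->
  (lebesgue_outer A <= \sum_(k <oo) (box_vol (b k))%:E)%E.
Proof. by move=> Ab; apply: ereal_inf_lbound; exists b. Qed.

(** The two pieces of a box cut by the hyperplane x_i = a. If the hyperplane misses the box, one
    piece has its sides in the wrong order, and [Num.max 0] in [box_vol] gives it volume 0. *)
Definition cut_below (i : 'I_n.+1) (a : R) (b : V * V) : V * V :=
  (b.1, \row_j if j == i then Num.min (b.2 ord0 j) a else b.2 ord0 j).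

Definition cut_above (i : 'I_n.+1) (a : R) (b : V * V) : V * V :=
  (\row_j (if j == i then Num.max (b.1 ord0 j) a else b.1 ord0 j), b.2).

Lemma box_vol_cut i a b :
  box_vol (cut_below i a b) + box_vol (cut_above i a b) = box_vol b.
Proof.
rewrite /box_vol (bigD1 i)//= [X in _ + X](bigD1 i)//= [RHS](bigD1 i)//=.
rewrite !mxE eqxx.
under eq_bigr => j /negbTE ji do rewrite !mxE ji.
under [X in _ + _ * X]eq_bigr => j /negbTE ji do rewrite !mxE ji.
rewrite -mulrDl; congr (_ * _).
move: (b.1 _ _) (b.2 _ _) => u v.
by case: (leP v a) => ?; case: (leP u a) => ?; do ?[case: leP => ?]; lra.
Qed.

(** By subadditivity one inequality of Caratheodory's criterion suffices: cutting each box of a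
    cover of X yields covers of both parts of X, with the same total volume. *)
Lemma measurable_halfspace i a : measurable [set x : V | x ord0 i < a].
Proof.
apply: (@le_caratheodory_measurable R V lebesgue_outer) => X.
apply: le_ereal_inf_tmp => _ [b Xb <-].
under eq_eseriesr do rewrite -(box_vol_cut i a) EFinD.
rewrite nneseriesD; last 2 first.
- by move=> k _ _; rewrite lee_fin box_vol_ge0.
- by move=> k _ _; rewrite lee_fin box_vol_ge0.
apply: leeD; apply: lebesgue_outer_cover => x [Xx /= xa].
- have [k _ bkx] := Xb _ Xx; exists k => // j /=; have := bkx j.
  rewrite !mxE; case: eqVneq => [->|//] /andP[-> xb].
  by rewrite /= lt_min xb xa.
- have [k _ bkx] := Xb _ Xx; exists k => // j /=; have := bkx j.
  rewrite !mxE; case: eqVneq => [->|//] /andP[xb ->].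
  by rewrite andbT ge_max xb/= leNgt; apply/negP.
Qed.

Lemma measurable_coord i : measurable_fun setT (fun x : V => x ord0 i).
Proof.
apply: (measurability _ (RGenInftyO.measurableE R)) => _ [_ [a ->] <-].
rewrite setTI; have := measurable_halfspace i a; congr measurable.
Qed.

Lemma measurable_enorm : measurable_fun setT (@enorm R n).
Proof.
have -> : @enorm R n = (fun y => y `^ 2^-1) \o (fun x => \sum_i x ord0 i ^+ 2).
  apply/funext => x /=; rewrite powR12_sqrt// sumr_ge0// => i _.
  exact: sqr_ge0.
apply: measurableT_comp => //.
apply: measurable_sum => i; apply: measurable_funX; exact: measurable_coord.
Qed.

Lemma measurable_dir : measurable_fun setT (@dir R n).
Proof. by move=> _ E mE; rewrite setTI. Qed.

Lemma measurable_eball r : measurable (@eball R n r).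
Proof.
rewrite -[eball r]setTI.
have -> : eball r = @enorm R n @^-1` `]-oo, r[.
  by apply/seteqP; split => x /=; rewrite in_itv.
exact: measurable_enorm.
Qed.

Lemma measurable_rV_ball (x : V) r : measurable (ball x r).
Proof.
have [r0|r0] := leP r 0.
  suff -> : ball x r = set0 by [].
  apply/seteqP; split => // y; rewrite -ball_normE/= => /(le_lt_trans (normr_ge0 _)).
  by rewrite ltNge r0.
have -> : ball x r = \bigcap_(i in [set: 'I_n.+1])
   ((fun y : V => y ord0 i) @^-1` (ball (x ord0 i) r)).
  apply/seteqP; split => [y xy i _ | y xy].
    exact: xy.2.
  by split=> // i j; rewrite (ord1 i); exact: xy.
apply: fin_bigcap_measurable => // i _.
rewrite -[X in measurable X]setTI; apply: measurable_coord => //.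
exact: measurable_ball.
Qed.

(** Balls with rational centre and radius 1/(k+1) form a countable base; [F] discards those not
    inside [U]. A radius below e/2 leaves room for the triangle inequality. *)
Lemma open_measurable_rV (U : set V) : open U -> measurable U.
Proof.
move=> oU.
pose F (qk : 'rV[rat]_n.+1 * nat) : set V :=
  let B := ball (map_mx ratr qk.1 : V) (qk.2.+1%:R^-1 : R) in
  if `[< B `<=` U >] then B else set0.
have -> : U = \bigcup_qk F qk.
  apply/seteqP; split => [x Ux|x [qk _]]; last first.
    by rewrite /F; case: asboolP => // BU Bx; exact: BU.
  have /nbhs_ballP[e /= e0 eU] : nbhs x U by rewrite nbhsE; exists U.
  have [k ke] : exists k : nat, (k.+1%:R^-1 : R) < e / 2.
    have e20 : 0 < e / 2 by rewrite divr_gt0.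
    exists (Num.truncn (e / 2)^-1).
    rewrite -[ltRHS]invrK ltf_pV2 ?posrE ?invr_gt0//.
    exact: truncnS_gt.
  have k0 : (0 : R) < k.+1%:R^-1 by rewrite invr_gt0.
  have H i : {q : rat | `|ratr q - x ord0 i| < k.+1%:R^-1}.
    apply/cid.
    have [q] : exists q, ratr q \in `](x ord0 i - k.+1%:R^-1), (x ord0 i + k.+1%:R^-1)[%R.
      apply: rat_in_itvoo; move: k0; set d := _^-1 => d0; lra.
    rewrite in_itv/= => /andP[h1 h2]; exists q.
    by rewrite ltr_distl h1.
  exists (\row_i sval (H i), k) => //; rewrite /F /=.
  have Bx : ball (map_mx ratr (\row_i sval (H i)) : V) k.+1%:R^-1 x.
    by split=> // i j; rewrite (ord1 i) !mxE; exact: (svalP (H j)).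
  rewrite asboolT// => y yB; apply: eU.
  have e2 : e = e / 2 + e / 2 by rewrite -splitr.
  rewrite e2; apply: (@ball_triangle _ _ (map_mx ratr (\row_i sval (H i)) : V)).
    by apply/ball_sym; apply: le_ball Bx; exact: ltW.
  by apply: le_ball yB; exact: ltW.
apply: countable_bigcupT_measurable => // qk; rewrite /F.
by case: asboolP => // _; exact: measurable_rV_ball.
Qed.

Lemma normr_coord_le_enorm x i : `|x ord0 i| <= enorm x.
Proof.
rewrite /enorm -sqrtr_sqr ler_wsqrtr// (bigD1 i)//= lerDl sumr_ge0// => j _.
exact: sqr_ge0.
Qed.

Lemma lebesgue_outer_box b : (lebesgue_outer (box b : set V) <= (box_vol b)%:E)%E.
Proof.
pose b' k : V * V := if k is 0%N then b else (0, 0).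
apply: (@le_trans _ _ (\sum_(k <oo) (box_vol (b' k))%:E)%E).
  by apply: lebesgue_outer_cover => x bx; exists 0%N.
rewrite nneseries_recl//=; last by move=> k; rewrite lee_fin box_vol_ge0.
rewrite eseries0 ?adde0// => -[//|k] _ _.
by rewrite /b' /box_vol/= big_ord_recl/= !mxE subr0 maxxx mul0r.
Qed.

Lemma eball_lty r : (lebesgue_n (eball r : set V) < +oo)%E.
Proof.
apply: (@le_lt_trans _ _ (box_vol (const_mx (- r) : V, const_mx r : V))%:E%E);
  last exact: ltry.
apply: le_trans (lebesgue_outer_box _).
apply: (@le_outer_measure R V lebesgue_outer) => x xr i; rewrite !mxE.
have := le_lt_trans (normr_coord_le_enorm x i) xr.
by rewrite ltr_norml => /andP[/ltW -> ->].
Qed.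

Lemma box_volZ r (b : V * V) : 0 <= r ->
  box_vol (r *: b.1, r *: b.2) = r ^+ n.+1 * box_vol b.
Proof.
move=> r0; rewrite /box_vol -[in r ^+ _](card_ord n.+1) -prodr_const -big_split/=.
by apply: eq_bigr => i _; rewrite !mxE -mulrBr -[in LHS](mulr0 r) maxr_pMr.
Qed.

Lemma lebesgue_outerZ_le r A : 0 < r ->
  (lebesgue_outer ( *:%R r @` A) <= (r ^+ n.+1)%:E * lebesgue_outer A)%E.
Proof.
move=> r0; rewrite -lee_pdivrMl ?exprn_gt0//.
apply: le_ereal_inf_tmp => _ [b Ab <-]; rewrite lee_pdivrMl ?exprn_gt0//.
rewrite -nneseriesZl; last by move=> *; rewrite lee_fin box_vol_ge0.
under eq_eseriesr do rewrite -EFinM -box_volZ ?ltW//.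
apply: (@lebesgue_outer_cover _ (fun k => (r *: (b k).1, r *: (b k).2))).
move=> _ [x Ax <-]; have [k _ bx] := Ab _ Ax; exists k => // i.
by have := bx i; rewrite !mxE /= ler_pM2l// ltr_pM2l.
Qed.

(** The reverse inequality is [lebesgue_outerZ_le] for 1/r, applied to the dilated set. As
    [lebesgue_n] is the outer measure itself, this holds for every set A. *)
Lemma lebesgue_nZ r A : 0 < r ->
  lebesgue_n ( *:%R r @` A) = ((r ^+ n.+1)%:E * lebesgue_n A)%E.
Proof.
move=> r0; apply/le_anti/andP; split; first exact: lebesgue_outerZ_le.
rewrite -lee_pdivlMl ?exprn_gt0// -exprVn.
have AE : A = *:%R r^-1 @` ( *:%R r @` A).
  rewrite image_comp -[LHS]image_id; apply: eq_imagel => x _ /=.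
  by rewrite scalerA mulVf ?scale1r ?gt_eqF.
by rewrite [in leLHS]AE; apply: lebesgue_outerZ_le; rewrite invr_gt0.
Qed.

Lemma dirZ r x : 0 < r -> dir (r *: x) = dir x.
Proof.
move=> r0; rewrite /dir enormZ gtr0_norm// scalerA invfM mulrAC mulVf ?mul1r//.
by rewrite gt_eqF.
Qed.

(** Dilations preserve [dir], so the cone of radius r is the dilated unit cone. *)
Lemma lebesgue_n_cone r (E : set (sphere R n)) : 0 < r ->
  lebesgue_n (eball r `&` dir @^-1` E) = ((r ^+ n.+1)%:E * cone_volume E)%E.
Proof.
move=> r0; rewrite /cone_volume -lebesgue_nZ//; congr lebesgue_n.
apply/seteqP; split => [x [xr Ex]|_ [x [x1 Ex] <-]].
  exists (r^-1 *: x); last by rewrite scalerA mulfV ?scale1r// gt_eqF.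
  split; last by rewrite /= dirZ// invr_gt0.
  by rewrite /eball/= enormZ gtr0_norm ?invr_gt0// ltr_pdivrMl// mulr1.
split; last by rewrite /= dirZ.
by rewrite /eball/= enormZ gtr0_norm// gtr_pMr.
Qed.

End euclidean_space.

(** * Polar coordinates *)

Lemma ge0_integral_mrestr d (T : measurableType d) (R : realType)
    (mu : {measure set T -> \bar R}) (D : set T) (mD : measurable D)
    (f : T -> \bar R) : measurable_fun setT f -> (forall x, 0 <= f x)%E ->
  (\int[mrestr mu mD]_x f x = \int[mu]_(x in D) f x)%E.
Proof.
move=> mf f0; have mCD : measurable (~` D) by exact: measurableC.
have mDC0 : mrestr mu mD (~` D) = 0%E by rewrite /mrestr/= setICl measure0.
have -> := @ge0_negligible_integral _ _ _ (mrestr mu mD) _ _ f mCD measurableT mf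
  (fun x _ => f0 x) mDC0.
rewrite setTD setCK; apply: eq_measure_integral => A mA AD.
by rewrite /= /mrestr setIidl.
Qed.

Section sphere_directions.
Context {R : realType} {n : nat}.
Local Notation V := 'rV[R]_n.+1.
Implicit Types (x : V) (r : R).

Lemma continuous_enorm : continuous (@enorm R n).
Proof.
move=> x; apply: (@continuous_comp _ _ _ (fun y : V => \sum_i y ord0 i ^+ 2));
  last exact: sqrt_continuous.
apply: continuous_big => [p|i _ y].
  exact: (@cvgD _ R^o _ _ _ (fst : R^o * R^o -> R^o) snd p.1 p.2 cvg_fst cvg_snd).
apply: (@continuous_comp _ _ _ (fun M : V => M ord0 i) (fun t : R => t ^+ 2)).
  exact: coord_continuous.
exact: exprn_continuous.
Qed.

Lemma enorm0 : enorm (0 : V) = 0.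
Proof. by rewrite -[X in enorm X](scale0r (0 : V)) enormZ normr0 mul0r. Qed.

Lemma enorm_gt0 x : (0 < enorm x) = (x != 0).
Proof.
rewrite lt_neqAle enorm_ge0 andbT eq_sym; congr negb; apply/eqP/eqP => [|->].
  exact: enorm_eq0.
exact: enorm0.
Qed.

Lemma near_rV_neq0 x : x != 0 -> nbhs x [set y : V | y != 0].
Proof.
move=> x0; have /cvgr_gt : enorm y @[y --> nbhs x] --> enorm x.
  exact: continuous_enorm.
have x_gt0 : 0 < enorm x by rewrite enorm_gt0.
by move=> /(_ _ x_gt0); apply: filterS => y; rewrite enorm_gt0.
Qed.

(** A neighbourhood of [dir x] in the sphere is the trace of an open B of the space, and near x <> 0
    the value of [dir] is y/|y|, which is continuous there. *)
Lemma continuous_dir x : x != 0 -> {for x, continuous (@dir R n)}.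
Proof.
move=> x0 A; rewrite nbhsE => -[_ [[B oB <-] Bx] BA].
have dirx : (enorm y)^-1 *: y @[y --> nbhs x] --> (enorm x)^-1 *: x.
  apply: (@cvgZ _ _ _ (nbhs x) (nbhs_filter x)); last exact: cvg_id.
  apply: (@cvgV _ _ (nbhs x) (nbhs_filter x)); last exact: continuous_enorm.
  by rewrite gt_eqF ?enorm_gt0.
have BxV : nbhs ((enorm x)^-1 *: x) B.
  by rewrite nbhsE; exists B => //; split=> //; rewrite -val_dir.
have := filterI (near_rV_neq0 x x0) (dirx _ BxV); move=> /(_ (nbhs_filter x)) Bdir.
have Adir : nbhs x (dir @^-1` A).
  apply: filterS Bdir => y [y0 By].
  by apply: BA; rewrite /= -val_dir in By.
exact: Adir.
Qed.

Lemma usphere_neq0 x : usphere x -> x != 0.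
Proof. by move=> x1; rewrite -enorm_gt0 x1. Qed.

Lemma compact_usphere : compact (@usphere R n).
Proof.
apply: bounded_closed_compact.
  exists 1; split => // M M1 x /= x1.
  rewrite [leLHS]mx_normrE; apply: bigmax_le => [|[i j] _ /=].
    exact: le_trans ler01 (ltW M1).
  by rewrite (ord1 i) (le_trans (normr_coord_le_enorm x j))// x1 ltW.
have -> : @usphere R n = @enorm R n @^-1` [set 1] by [].
by apply: closed_comp => // x _; exact: continuous_enorm.
Qed.

(** The extreme value theorem is applied to [S0 \o dir] on the unit sphere as a compact set of row
    vectors, where [dir] is the identity. *)
Lemma continuous_sphere_lbound (S0 : sphere R n -> R) : continuous S0 ->
  (forall xi, 0 < S0 xi) -> exists2 m, 0 < m & forall xi, m <= S0 xi.
Proof.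
move=> cS0 S0_gt0.
have [||c _ cmin] := @EVT_min_rV R n.+1 (S0 \o @dir R n) _ _ compact_usphere.
- by exists (delta_mx 0 0); exact: enorm_delta.
- apply: continuous_in_subspaceT => x /[!inE] /usphere_neq0 x0.
  by apply: continuous_comp; [exact: continuous_dir|exact: cS0].
exists (S0 (dir c)) => // xi.
have xi1 : usphere (val xi) by exact: set_valP.
have := cmin (val xi); rewrite inE => /(_ xi1) /=.
suff -> : dir (val xi) = xi by [].
by apply: val_inj; rewrite val_dir ?usphere_neq0// xi1 invr1 scale1r.
Qed.

(** [S0 \o dir] is continuous off the origin, so preimages of open rays are open up to the single
    point 0. *)
Lemma measurable_continuous_sphere (S0 : sphere R n -> R) : continuous S0 ->
  measurable_fun setT S0.
Proof.
move=> cS0.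
suff mS0 : measurable_fun setT (S0 \o @dir R n).
  by move=> _ Y mY; rewrite setTI; have := mS0 measurableT Y mY; rewrite setTI.
apply: (measurability _ (RGenInftyO.measurableE R)) => _ [_ [a ->] <-].
rewrite setTI.
pose U : set V := [set x | x != 0 /\ S0 (dir x) < a].
have mU : measurable U.
  apply: open_measurable_rV; rewrite openE => x [x0 xa]; rewrite /interior.
  apply: filterI; first exact: near_rV_neq0.
  have /cvgr_lt : S0 (dir y) @[y --> nbhs x] --> S0 (dir x).
    by apply: continuous_comp; [exact: continuous_dir|exact: cS0].
  exact.
have m0 : measurable [set 0 : V].
  rewrite -[X in measurable X]setCK; apply: measurableC.
  apply: open_measurable_rV; rewrite openE => x /eqP x0.
  have := near_rV_neq0 x x0; apply: filterS => y /eqP; exact.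
(* At 0 [dir] takes its default value: the origin lies in the preimage or not according to [S0]
   there. *)
have [a0|a0] := ltP (S0 (dir 0)) a.
  have -> : (S0 \o @dir R n) @^-1` `]-oo, a[ = U `|` [set 0].
    apply/seteqP; split => x; rewrite /U/= in_itv/=.
      by have [->|x0] := eqVneq x 0; [right|left].
    by case=> [[_ //]|->].
  exact: measurableU.
suff -> : (S0 \o @dir R n) @^-1` `]-oo, a[ = U by [].
apply/seteqP; split => x; rewrite /U/= in_itv/=; last by case.
by move=> xa; split => //; apply: contraTneq xa => ->; rewrite -leNgt.
Qed.

Lemma cone_volume_fin_num : fin_num_fun (@cone_volume R n).
Proof.
move=> E mE; rewrite ge0_fin_numE//; apply: le_lt_trans (eball_lty 1).
apply: le_measure; rewrite ?inE; [|exact: measurable_eball|exact: subIsetl].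
by apply: measurableI => //; exact: measurable_eball.
Qed.

HB.instance Definition _ := @Measure_isFinite.Build _ (sphere R n) R
  (@cone_volume R n) cone_volume_fin_num.

(** A measure on the whole line, because product measures and Tonelli's theorem are about measures
    on full spaces; [ge0_integral_mrestr] returns to integrals over the half-line. *)
Definition lebesgue_pos : set (measurableTypeR R) -> \bar R :=
  mrestr lebesgue_measure (measurable_itv `]0, +oo[%R).

HB.instance Definition _ := Measure.on lebesgue_pos.

Lemma lebesgue_pos_sigma_finite : sigma_finite setT lebesgue_pos.
Proof.
have /sigma_finiteP[F [FT _ Foo]] := sigma_finiteT (@lebesgue_measure R).
exists F => // i; have [mF Fi] := Foo i; split => //.
apply: le_lt_trans Fi; rewrite /lebesgue_pos /mrestr.
by apply: le_measure; rewrite ?inE//; exact: measurableI.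
Qed.

HB.instance Definition _ := Measure_isSigmaFinite.Build _ _ _ lebesgue_pos
  lebesgue_pos_sigma_finite.

Lemma lebesgue_pos_itv r :
  lebesgue_pos `]-oo, r[ = (Num.max 0 r)%:E.
Proof.
rewrite /lebesgue_pos /mrestr.
have -> : `]-oo, r[ `&` [set` `]0, +oo[%R] = `]0, r[%classic :> set R.
  apply/seteqP; split => t /=; rewrite !in_itv/= andbT; first by move=> [-> ->].
  by move=> /andP[-> ->].
rewrite lebesgue_measure_itv/= lte_fin sube0.
by case: (leP r 0).
Qed.

(** With the radius r itself the image measure would have the density (n+1) r^n; the power n+1,
    which is the dimension, absorbs it. *)
Definition polar_coord (x : V) : measurableTypeR R * sphere R n :=
  (enorm x ^+ n.+1, dir x).

Lemma measurable_polar_coord : measurable_fun setT polar_coord.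
Proof.
apply: measurable_fun_pair; last exact: measurable_dir.
by apply: measurable_funX; exact: measurable_enorm.
Qed.

(** For fixed E both sides are measures in A. They are equal and finite on the half-lines ]-oo, r[,
    which are stable under intersection, generate the Borel sets and exhaust the line. *)
Lemma lebesgue_n_polar_rectangle (A : set R) (E : set (sphere R n)) :
  measurable A -> measurable E ->
  lebesgue_n (polar_coord @^-1` (A `*` E)) = (lebesgue_pos A * cone_volume E)%E.
Proof.
move=> mA mE.
have mdE : measurable ((@dir R n) @^-1` E).
  by rewrite -[X in measurable X]setTI; exact: measurable_dir.
have mN : measurable_fun setT (fun x : V => enorm x ^+ n.+1 : measurableTypeR R).
  by apply: measurable_funX; exact: measurable_enorm.
pose m1 : {measure set (measurableTypeR R) -> \bar R} :=
  measure_function_pushforward__canonical__measure_function_Measure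
    (mrestr lebesgue_n mdE) mN.
have cE : (0 <= fine (cone_volume E))%R by rewrite fine_ge0.
pose m2 : {measure set (measurableTypeR R) -> \bar R} :=
  mscale (NngNum cE) lebesgue_pos.
have itv_m1 (r : R) : m1 `]-oo, r[%classic = ((Num.max 0 r)%:E * cone_volume E)%E.
  rewrite /m1/= /pushforward /mrestr.
  case: (leP r 0) => r0.
    rewrite mul0e (_ : _ `&` _ = set0) ?measure0//.
    apply/seteqP; split => // x [/=]; rewrite in_itv/= => xr _.
    by move: xr; rewrite ltNge (le_trans r0)// exprn_ge0// enorm_ge0.
  (* |x|^(n+1) < r means |x| < s, so the set is the cone of radius s, of volume s^(n+1) = r times
     the cone volume. *)
  pose s := r `^ n.+1%:R^-1.
  have s0 : 0 < s by rewrite powR_gt0.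
  have sE : s ^+ n.+1 = r.
    by rewrite -powR_mulrn ?ltW// -powRrM mulVf ?powRr1 ?ltW// pnatr_eq0.
  rewrite -[in RHS]sE -lebesgue_n_cone//; congr lebesgue_n; congr (_ `&` _).
  apply/seteqP; split => x /=; rewrite in_itv/= /eball/= -sE.
    by rewrite ltr_pXn2r// nnegrE ?enorm_ge0// ltW.
  by rewrite ltr_pXn2r// nnegrE ?enorm_ge0// ltW.
have m12 : m1 A = m2 A.
  refine (@measure_unique _ R (measurableTypeR R) (@RGenInftyO.G R)
    (fun k : nat => `]-oo, (k%:R : R)[%classic) _ _ _ _ m1 m2 _ _ A mA).
  - exact: RGenInftyO.measurableE.
  - move=> _ _ [r ->] [s ->]; exists (Num.min r s).
    by apply/seteqP; split => x /=; rewrite !in_itv/= lt_min => /andP.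
  - by move=> k; exists k%:R.
  - apply/seteqP; split => // x _; exists (Num.truncn x).+1 => //=.
    by rewrite in_itv/= truncnS_gt.
  - move=> _ [r ->]; rewrite itv_m1 /m2 /= /mscale/= lebesgue_pos_itv muleC.
    by rewrite fineK// cone_volume_fin_num.
  - move=> k; rewrite itv_m1 lte_mul_pinfty ?lee_fin ?le_max ?lexx//.
    by rewrite -ge0_fin_numE// cone_volume_fin_num.
have -> : polar_coord @^-1` (A `*` E) =
    (fun x : V => enorm x ^+ n.+1) @^-1` A `&` dir @^-1` E by [].
rewrite -[LHS]/(m1 A) m12 /m2/= /mscale/= muleC fineK//.
exact: cone_volume_fin_num.
Qed.

(** Agreement on rectangles identifies the image measure with the product measure; Tonelli's theorem
    does the rest. *)
Lemma ge0_integral_polar (k : measurableTypeR R * sphere R n -> \bar R) :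
  measurable_fun setT k -> (forall p, 0 <= k p)%E ->
  (\int[lebesgue_n]_x k (polar_coord x) =
   \int[@cone_volume R n]_xi \int[lebesgue_measure]_(t in `]0%R, +oo[) k (t, xi))%E.
Proof.
move=> mk k0.
pose m' : {measure set (measurableTypeR R * sphere R n) -> \bar R} :=
  measure_function_pushforward__canonical__measure_function_Measure
    lebesgue_n measurable_polar_coord.
transitivity (\int[m']_p k p)%E.
  rewrite ge0_integral_pushforward ?preimage_setT//.
  exact: measurable_polar_coord.
transitivity (\int[lebesgue_pos \x @cone_volume R n]_p k p)%E.
  apply: eq_measure_integral => X mX _; apply/esym/product_measure_unique => // A B mA mB.
  exact: lebesgue_n_polar_rectangle.
have -> := @fubini_tonelli2 _ _ _ _ _ lebesgue_pos (@cone_volume R n) k mk k0.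
apply: eq_integral => xi _; rewrite /fubini_G.
apply: ge0_integral_mrestr.
- apply: measurableT_comp => //; exact: measurable_pair2.
- by move=> t; exact: k0.
Qed.

End sphere_directions.

(** * Power substitutions and the Gamma integral *)

Section power_substitution.
Context {R : realType}.
Notation mu := (@lebesgue_measure R).

Lemma continuous_powR (a x : R) : 0 < x -> {for x, continuous (@powR R ^~ a)}.
Proof.
move=> x0; apply: differentiable_continuous; apply/derivable1_diffP.
by have [] := is_derive1_powR a x0.
Qed.

Lemma continuous_itv0y_measurable (G : R -> R) :
  {in `]0, +oo[%R, continuous G} -> measurable_fun (`]0, +oo[%classic : set R) G.
Proof.
move=> cG; apply: open_continuous_measurable_fun => //.
by move=> x; rewrite inE => ?; exact: cG.
Qed.

Lemma powR_cvg_pinfty (al : R) : 0 < al -> t `^ al @[t --> +oo] --> +oo.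
Proof.
move=> al0; apply/cvgryPge => A.
near=> t.
have tA : (Num.max 1 A) `^ al^-1 <= t by near: t; apply: nbhs_pinfty_ge; exact: num_real.
apply: (@le_trans _ _ (Num.max 1 A)); first by rewrite le_max lexx orbT.
have m0 : 0 <= Num.max 1 A by rewrite le_max ler01.
rewrite -[leLHS]powRr1// -(mulVf (lt0r_neq0 al0)) powRrM.
by rewrite ge0_ler_powR ?nnegrE ?powR_ge0 ?ltW// (le_trans _ tA)// powR_ge0.
Unshelve. all: by end_near. Qed.

Lemma bigcup_itv_exhaust (u v : nat -> R) :
  (forall k, 0 < u k) -> u k @[k --> \oo] --> 0 -> v k @[k --> \oo] --> +oo ->
  \bigcup_k `[u k, v k]%classic = `]0, +oo[%classic.
Proof.
move=> u0 cu cv; apply/seteqP; split => [t [k _]/=|t /=].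
  by rewrite !in_itv/= andbT => /andP[+ _]; apply: lt_le_trans.
rewrite in_itv/= andbT => t0.
near \oo => k; exists k => //=; rewrite in_itv/=; apply/andP; split.
  near: k; apply: (cvgr_le 0) => //.
near: k; move/cvgryPge : cv; exact.
Unshelve. all: by end_near. Qed.

(* dt / t is invariant under dilations and the substitution t = u ^ al multiplies it by al. *)
Lemma ge0_integral_powR_subst (s al : R) (G : R -> R) : 0 < s -> 0 < al ->
  {in `]0, +oo[%R, continuous G} -> (forall t : R, 0 < t -> 0 <= G t) ->
  (\int[mu]_(t in `]0%R, +oo[) (G (s * t `^ al) * (s * (al * t `^ (al - 1))))%:E =
   \int[mu]_(t in `]0%R, +oo[) (G t)%:E)%E.
Proof.
move=> s0 al0 cG G0.
pose F (t : R) := s * t `^ al.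
pose H (t : R) := G (F t) * (s * (al * t `^ (al - 1))).
have F0 (t : R) : 0 < t -> 0 < F t by move=> t0; rewrite mulr_gt0// powR_gt0.
have dF (t : R) : 0 < t -> is_derive t (1 : R) F (s * (al * t `^ (al - 1))).
  move=> t0; rewrite /F; have := is_derive1_powR al t0 => ?.
  by apply: is_deriveZ.
have cF (t : R) : 0 < t -> {for t, continuous F}.
  move=> t0; apply: differentiable_continuous; apply/derivable1_diffP.
  by have [] := dF t t0.
have cpF (t : R) : 0 < t -> {for t, continuous (fun t => s * (al * t `^ (al - 1)))}.
  move=> t0; apply: cvgM; first exact: cvg_cst.
  by apply: cvgM; [exact: cvg_cst|exact: continuous_powR].
have cH : {in `]0, +oo[%R, continuous H}.
  move=> t; rewrite in_itv/= andbT => t0; apply: cvgM; last exact: cpF.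
  apply: continuous_comp; first exact: cF.
  by apply: cG; rewrite in_itv/= F0.
(* The integrand may be singular at 0, so the substitution is made on compact intervals [u k, v k]
   and monotone convergence extends it to the half-line. *)
pose u k : R := k.+1%:R^-1; pose v k : R := k.+1%:R.
have u0 k : 0 < u k by rewrite invr_gt0.
have v0 k : 0 < v k by rewrite ltr0n.
have cu : u k @[k --> \oo] --> (0 : R) by exact: cvg_harmonic.
have cv : v k @[k --> \oo] --> +oo.
  apply/cvgryPge => A; near=> k.
  apply: (@le_trans _ _ k%:R); last by rewrite ler_nat.
  by near: k; apply: nbhs_infty_ger; exact: num_real.
have uv k : u k <= v k.
  by rewrite (@le_trans _ _ 1)// ?invf_le1 ?ler1n.
have incF (x y : R) : 0 < x -> 0 < y -> x < y -> F x < F y.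
  by move=> x0 y0 xy; rewrite ltr_pM2l// gt0_ltr_powR// ?nnegrE ltW.
have leF (x y : R) : 0 < x -> 0 < y -> x <= y -> F x <= F y.
  by move=> x0 y0 xy; rewrite ler_pM2l// ge0_ler_powR// ?nnegrE ltW.
have eqk k : (\int[mu]_(t in `[F (u k), F (v k)]) (G t)%:E =
    \int[mu]_(t in `[u k, v k]) (H t)%:E)%E.
  have pos (t : R) : t \in `[u k, v k]%R -> 0 < t.
    by rewrite in_itv/= => /andP[+ _]; exact: lt_le_trans.
  have F'E (t : R) : 0 < t -> F^`()%classic t = s * (al * t `^ (al - 1)).
    by move=> t0; rewrite derive1E; have [_ ->] := dF t t0.
  have cF' (t : R) : 0 < t -> {for t, continuous F^`()%classic}.
    move=> t0.
    have E : {near t, (fun t => s * (al * t `^ (al - 1))) =1 F^`()%classic}.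
      by near=> y; apply/esym/F'E; near: y; exact: lt_nbhsr.
    rewrite /prop_for/= /continuous_at F'E//.
    by apply: cvg_trans (near_eq_cvg E) _; exact: cpF.
  rewrite (@integration_by_substitution_increasing _ F G)//.
  - by apply: eq_integral => t; rewrite inE => /pos t0; rewrite /H/= fctE F'E.
  - by move=> x y xk yk; apply: incF; exact: pos.
  - by move=> t /subset_itv_oo_cc /pos; exact: cF'.
  - apply/cvg_ex; eexists; apply: cvg_at_right_filter; exact: cF'.
  - apply/cvg_ex; eexists; apply: cvg_at_left_filter; exact: cF'.
  - split => [t /subset_itv_oo_cc /pos t0||].
    + by have [] := dF t t0.
    + by apply: cvg_at_right_filter; exact: cF.
    + by apply: cvg_at_left_filter; exact: cF.
  - apply: continuous_in_subspaceT => t; rewrite inE/= in_itv/= => /andP[ft _].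
    by apply: cG; rewrite in_itv/= andbT (lt_le_trans _ ft)// F0.
have sub (a b : R) : 0 < a -> (`[a, b]%classic : set R) `<=` `]0, +oo[%classic.
  by move=> a0 t/=; rewrite !in_itv/= andbT => /andP[+ _]; apply: lt_le_trans.
have cvg1 : (\int[mu]_(t in `[F (u k), F (v k)]) (G t)%:E @[k --> \oo] -->
   \int[mu]_(t in `]0%R, +oo[) (G t)%:E)%E.
  rewrite -(@bigcup_itv_exhaust (F \o u) (F \o v)); last 3 first.
  - by move=> k; exact: F0.
  - have cu' : u k @[k --> \oo] --> 0^'+.
      move=> A [e /= e0 eA]; have /cvgrPdist_lt/(_ e e0) := cu.
      by apply: filterS => k /= ke; apply: eA => //; exact: u0.
    rewrite -(mulr0 s); apply: cvgM; first exact: cvg_cst.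
    exact: cvg_comp cu' (powR_cvg0 al0).
  - have /cvgryPge cva := cvg_comp _ _ cv (powR_cvg_pinfty al al0).
    apply/cvgryPge => A; have := cva (s^-1 * A); apply: filterS => k /=.
    by rewrite ler_pdivrMl.
  apply: ge0_nondecreasing_set_cvg_integral => //.
  - move=> k l kl; apply/subsetPset; apply: subset_itv; rewrite bnd_simp.
      by apply: leF => //; rewrite /u lef_pV2 ?posrE ?ltr0n// ler_nat.
    by apply: leF => //; rewrite /v ler_nat.
  - move=> k; apply/measurable_EFinP; have := continuous_itv0y_measurable G cG.
    by apply: measurable_funS => //; apply: sub; exact: F0.
  - by move=> k t /(sub _ _ (F0 _ (u0 k))); rewrite /= in_itv/= andbT lee_fin; exact: G0.
have cvg2 : (\int[mu]_(t in `[u k, v k]) (H t)%:E @[k --> \oo] -->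
   \int[mu]_(t in `]0%R, +oo[) (H t)%:E)%E.
  rewrite -(@bigcup_itv_exhaust u v)//.
  apply: ge0_nondecreasing_set_cvg_integral => //.
  - move=> k l kl; apply/subsetPset; apply: subset_itv; rewrite bnd_simp.
      by rewrite /u lef_pV2 ?posrE ?ltr0n// ler_nat.
    by rewrite /v ler_nat.
  - move=> k; apply/measurable_EFinP; have := continuous_itv0y_measurable H cH.
    by apply: measurable_funS => //; exact: sub.
  - move=> k t /(sub _ _ (u0 k)); rewrite /= in_itv/= andbT lee_fin => t0.
    by rewrite mulr_ge0 ?G0 ?F0// !mulr_ge0 ?powR_ge0// ltW.
have eqc : (fun k => \int[mu]_(t in `[F (u k), F (v k)]) (G t)%:E)%E =
    (fun k => \int[mu]_(t in `[u k, v k]) (H t)%:E)%E by apply/funext.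
rewrite eqc in cvg1.
exact: (cvg_unique _ cvg2 cvg1).
Unshelve. all: by end_near. Qed.

(** For G(t) = phi(t) t^(be/al - 1), the product of G(s t^al) and the derivative of s t^al is al
    s^(be/al) phi(s t^al) t^(be - 1). *)
Lemma ge0_integral_gamma_subst (s al be : R) (phi : R -> R) : 0 < s -> 0 < al ->
  {in `]0, +oo[%R, continuous phi} -> (forall t : R, 0 < t -> 0 <= phi t) ->
  (\int[mu]_(t in `]0%R, +oo[) (phi (s * t `^ al) * t `^ (be - 1))%:E =
   (al^-1 * s `^ (- (be / al)))%:E *
   \int[mu]_(t in `]0%R, +oo[) (phi t * t `^ (be / al - 1))%:E)%E.
Proof.
move=> s0 al0 cphi phi0.
pose G (t : R) := phi t * t `^ (be / al - 1).
have cG : {in `]0, +oo[%R, continuous G}.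
  move=> t t0; apply: cvgM; first exact: cphi.
  by apply: continuous_powR; move: t0; rewrite in_itv/= andbT.
have G0 (t : R) : 0 < t -> 0 <= G t.
  by move=> t0; rewrite mulr_ge0 ?powR_ge0 ?phi0.
rewrite -(ge0_integral_powR_subst s al G s0 al0 cG G0).
have c0 : 0 <= al^-1 * s `^ (- (be / al)) by rewrite mulr_ge0 ?invr_ge0 ?powR_ge0// ltW.
rewrite -ge0_integralZl_EFin//=.
- apply: eq_integral => t; rewrite inE/= in_itv/= andbT => t0; rewrite -EFinM; congr EFin.
  suff key : t `^ (be - 1) = al^-1 * s `^ (- (be / al)) *
      ((s * t `^ al) `^ (be / al - 1) * (s * (al * t `^ (al - 1)))).
    by rewrite /G key; ring.
  rewrite powRM ?powR_ge0 ?ltW// -powRrM.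
  have -> : al * (be / al - 1) = be - al by rewrite mulrBr mulr1 mulrCA divff ?gt_eqF// mulr1.
  have -> : be - 1 = (be - al) + (al - 1) by ring.
  have t1 : t != 0 by rewrite gt_eqF.
  have s1 : s != 0 by rewrite gt_eqF.
  rewrite [in LHS]powRD ?t1 ?implybT//.
  have -> : s `^ (- (be / al)) = (s `^ (be / al - 1))^-1 * s^-1.
    rewrite -powRN -[s^-1]powR_inv1 ?ltW// -powRD ?s1 ?implybT//.
    by congr (_ `^ _); ring.
  have a1 : al != 0 by rewrite gt_eqF.
  have b1 : s `^ (be / al - 1) != 0 by rewrite gt_eqF// powR_gt0.
  by field; rewrite a1 b1 s1.
- move=> t; rewrite /= in_itv/= andbT => t0; rewrite lee_fin.
  rewrite mulr_ge0 ?G0 ?mulr_gt0 ?powR_gt0//.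
  by rewrite !mulr_ge0 ?powR_ge0// ltW.
- apply/measurable_EFinP; apply: continuous_itv0y_measurable => t t0.
  have t0' : 0 < t by move: t0; rewrite in_itv/= andbT.
  apply: cvgM.
    apply: (@continuous_comp _ _ _ (fun x => s * x `^ al) G).
      by apply: cvgM; [exact: cvg_cst|exact: continuous_powR].
    by apply: cG; rewrite in_itv/= andbT mulr_gt0 ?powR_gt0.
  apply: cvgM; first exact: cvg_cst.
  by apply: cvgM; [exact: cvg_cst|exact: continuous_powR].
Qed.

End power_substitution.

(** * Convergence and scaling of the Gamma integral *)

Section gamma_integrals.
Context {R : realType}.
Notation mu := (@lebesgue_measure R).

(** For an integer k >= a, one term (c t)^k / k! of the exponential series already dominates a
    multiple of t^a on t >= 1. *)
Lemma expR_decay (a c : R) : 0 < c ->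
  exists C : R, 0 < C /\ forall t : R, 1 <= t -> expR (- (c * t)) <= C * t `^ (- a).
Proof.
move=> c0; pose k := (Num.truncn `|a|).+1.
have ak : a <= k%:R.
  by apply: le_trans (ler_norm a) _; apply: ltW; exact: truncnS_gt.
exists (k`!%:R / c ^+ k); split.
  by rewrite divr_gt0// ?exprn_gt0// ltr0n fact_gt0.
move=> t t1; have t0 : 0 < t by exact: lt_le_trans t1.
have fk0 : (0 : R) < k`!%:R by rewrite ltr0n fact_gt0.
have ck0 : 0 < c ^+ k by rewrite exprn_gt0.
have X0 : 0 < t `^ a by rewrite powR_gt0.
rewrite expRN powRN.
have -> : k`!%:R / c ^+ k * (t `^ a)^-1 = (t `^ a * (c ^+ k / k`!%:R))^-1.
  by field; rewrite !gt_eqF.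
rewrite lef_pV2 ?posrE ?expR_gt0 ?mulr_gt0 ?invr_gt0//.
apply: (@le_trans _ _ (t ^+ k * (c ^+ k / k`!%:R))).
  rewrite ler_wpM2r ?divr_ge0 ?exprn_ge0 ?(ltW c0) ?(ltW fk0)// -powR_mulrn ?(ltW t0)//.
  exact: ler_powR.
have := @expR_ge1Dxn R (c * t) k.-1 (ltW (mulr_gt0 c0 t0)).
rewrite exprMn /= => le1; apply: le_trans le1.
have -> : t ^+ k * (c ^+ k / k`!%:R) = c ^+ k * t ^+ k / k`!%:R by ring.
by rewrite lerDr.
Qed.

Lemma integrable_oneDsqrV :
  mu.-integrable `]0%R, +oo[%classic (EFin \o (fun t : R => (oneDsqr t)^-1)).
Proof.
have m1 : measurable_fun (setT : set R) (fun t : R => (oneDsqr t)^-1).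
  apply: continuous_measurable_fun; exact: continuous_oneDsqrV.
have m2 : measurable_fun (`]0%R, +oo[%classic : set R) (EFin \o (fun t : R => (oneDsqr t)^-1)).
  by apply/measurable_EFinP; apply: measurable_funTS.
apply/integrableP; split => //.
rewrite -[ltRHS]/(+oo)%E.
under eq_integral => t _.
  rewrite gee0_abs; last by rewrite lee_fin invr_ge0 (le_trans ler01) ?oneDsqr_ge1.
  over.
by rewrite integral_itv_obnd_cbnd// integral0y_oneDsqr ltry.
Qed.

(* The substitution t = u ^ (1 / a) makes the Gamma integrand bounded at 0. *)
Lemma ge0_gamma_integral_lty (a : R) : 0 < a ->
  (\int[mu]_(t in `]0%R, +oo[) (expR (- t) * t `^ (a - 1))%:E < +oo)%E.
Proof.
move=> a0.
have cphi : {in `]0, +oo[%R, continuous (fun t : R => expR (- t))}.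
  move=> t _; apply: continuous_comp; last exact: continuous_expR.
  exact: continuousN.
have phi0 (t : R) : 0 < t -> 0 <= expR (- t) by rewrite expR_ge0.
have ai0 : 0 < a^-1 by rewrite invr_gt0.
have := ge0_integral_gamma_subst 1 a^-1 1 (fun t => expR (- t)) ltr01 ai0 cphi phi0.
rewrite invrK powR1 mulr1 mul1r => E.
suff : (a%:E * \int[mu]_(t in `]0%R, +oo[) (expR (- t) * t `^ (a - 1))%:E < +oo)%E.
  by rewrite -lte_pdivlMl// mulry gtr0_sg ?invr_gt0// mul1e.
rewrite -E subrr.
(* The integrand is now exp(-t^(1/a)), and exponent 2a bounds it by C t^(-2) for t >= 1. Multiplied
   by 1 + t^2 it is at most 2 for t <= 1 and 2C for t >= 1, hence the majorant M / (1 + t^2). *)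
have [C [C0 HC]] := expR_decay (2 * a) 1 ltr01.
pose M : R := Num.max 2 (2 * C).
have M2 : 2 <= M by rewrite le_max lexx.
have MC : 2 * C <= M by rewrite le_max lexx orbT.
have M0 : 0 <= M by rewrite (le_trans _ M2).
have mexp : measurable_fun (`]0%R, +oo[%classic : set R)
    (fun t => (expR (- (1 * t `^ a^-1)) * t `^ 0)%:E).
  apply/measurable_EFinP; apply: continuous_itv0y_measurable => t.
  rewrite in_itv/= andbT => t0; apply: cvgM; last exact: continuous_powR.
  apply: continuous_comp; last exact: continuous_expR.
  apply: continuousN; apply: cvgM; first exact: cvg_cst.
  exact: continuous_powR.
have iM : mu.-integrable `]0%R, +oo[%classic (fun t : R => (M%:E * ((oneDsqr t)^-1)%:E)%E).
  by apply: integrableZl integrable_oneDsqrV.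
apply: (le_lt_trans _ (integrable_lty _ iM)) => //.
apply: ge0_le_integral => //.
- by move=> t _; rewrite lee_fin mulr_ge0 ?expR_ge0 ?powR_ge0.
- exact: measurable_int iM.
move=> t; rewrite /= in_itv/= andbT => t0; rewrite -EFinM lee_fin powRr0 mulr1 mul1r.
have D0 : 0 < oneDsqr t by rewrite (lt_le_trans ltr01) ?oneDsqr_ge1.
rewrite ler_pdivlMr//.
have [t1|t1] := leP t 1.
  apply: le_trans M2; rewrite -[leRHS]mul1r.
  apply: ler_pM; rewrite ?expR_ge0 ?(ltW D0)//.
    by rewrite -expR0 ler_expR oppr_le0 powR_ge0.
  by rewrite /oneDsqr -[X in _ <= X]/(1 + 1) lerD2l expr_le1// ltW.
apply: le_trans MC.
have ta1 : 1 <= t `^ a^-1.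
  by rewrite -[leLHS](powRr0 t) ler_powR// ltW.
have := HC _ ta1; rewrite mul1r -powRrM.
have -> : a^-1 * - (2 * a) = - (2%:R) by field; rewrite gt_eqF.
rewrite powRN powR_mulrn ?(ltW t0)// => le1.
apply: (@le_trans _ _ (C * (t ^+ 2)^-1 * oneDsqr t)).
  by rewrite ler_wpM2r// ltW.
rewrite /oneDsqr [2 * C]mulrC -mulrA ler_wpM2l ?(ltW C0)//.
rewrite mulrDr mulr1 mulVf ?gt_eqF ?exprn_gt0//.
rewrite -[leRHS]/(1 + 1) lerD2r invf_le1 ?exprn_gt0//.
by rewrite exprn_ege1// ltW.
Qed.

Lemma ge0_gamma_integralZ (a p : R) : 0 < a -> 0 < p ->
  (\int[mu]_(t in `]0%R, +oo[) (expR (- (p * t)) * t `^ (a - 1))%:E =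
  (p `^ (- a))%:E * \int[mu]_(t in `]0%R, +oo[) (expR (- t) * t `^ (a - 1))%:E)%E.
Proof.
move=> a0 p0.
have cphi : {in `]0, +oo[%R, continuous (fun t : R => expR (- t))}.
  move=> t _; apply: continuous_comp; last exact: continuous_expR.
  exact: continuousN.
have phi0 (t : R) : 0 < t -> 0 <= expR (- t) by rewrite expR_ge0.
have := ge0_integral_gamma_subst p 1 a (fun t => expR (- t)) p0 ltr01 cphi phi0.
rewrite invr1 mul1r mulr1 => <-; apply: eq_integral => t.
by rewrite inE/= in_itv/= andbT => t0; rewrite powRr1 ?ltW.
Qed.

Lemma measurable_gamma (a p : R) :
  measurable_fun (`]0%R, +oo[%classic : set R) (fun t => expR (- (p * t)) * t `^ (a - 1)).
Proof.
apply: continuous_itv0y_measurable => t.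
rewrite in_itv/= andbT => t0; apply: cvgM; last exact: continuous_powR.
apply: continuous_comp; last exact: continuous_expR.
by apply: continuousN; apply: cvgM; [exact: cvg_cst|exact: cvg_id].
Qed.

Lemma integrable_gamma (a p : R) : 0 < a -> 0 < p ->
  mu.-integrable `]0%R, +oo[%classic (fun t : R => (expR (- (p * t)) * t `^ (a - 1))%:E).
Proof.
move=> a0 p0; apply/integrableP; split; first by apply/measurable_EFinP; exact: measurable_gamma.
under eq_integral => t _.
  rewrite gee0_abs; last by rewrite lee_fin mulr_ge0 ?expR_ge0 ?powR_ge0.
  over.
rewrite /= ge0_gamma_integralZ// lte_mul_pinfty ?lee_fin ?powR_ge0//.
exact: ge0_gamma_integral_lty.
Qed.

Lemma GammaE (a : R) : Gamma a = \int[mu]_(t in `]0%R, +oo[) (expR (- t) * t `^ (a - 1)).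
Proof. by apply: eq_Rintegral => t _; rewrite mulrC. Qed.

Lemma Rintegral_gamma (a p : R) : 0 < a -> 0 < p ->
  \int[mu]_(t in `]0%R, +oo[) (expR (- (p * t)) * t `^ (a - 1)) = p `^ (- a) * Gamma a.
Proof.
move=> a0 p0; rewrite GammaE /Rintegral ge0_gamma_integralZ// fineM//.
rewrite ge0_fin_numE ?ge0_gamma_integral_lty//.
by apply: integral_ge0 => t _; rewrite lee_fin mulr_ge0 ?expR_ge0 ?powR_ge0.
Qed.

Lemma Gamma_ge0 (a : R) : 0 <= Gamma a.
Proof.
by apply: Rintegral_ge0 => t _; rewrite mulr_ge0 ?expR_ge0 ?powR_ge0.
Qed.

End gamma_integrals.

(** * Rotation of the Gamma integral *)

Section gamma_rotation.
Context {R : realType}.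
Notation mu := (@lebesgue_measure R).
Variables (a Z al : R).
Hypotheses (a0 : 0 < a) (Z0 : 0 < Z).

(** The real part of exp(i (a th + al)) exp(-Z e^(i th) t) t^(a-1). The free phase [al] lets one
    statement yield both the cosine and the sine integral. *)
Definition rotated_gamma (th t : R) : R :=
  expR (- (Z * cos th * t)) * cos (a * th - Z * sin th * t + al) * t `^ (a - 1).

(** The real part of i exp(i (a th + al)) exp(-Z e^(i th) t) t^a. *)
Definition rotated_primitive (th t : R) : R :=
  - (expR (- (Z * cos th * t)) * sin (a * th - Z * sin th * t + al) * t `^ a).

(* Multiplied by exp(i (a th + al)), the integrand depends on th only through
   exp(- Z e^(i th) t) e^(i a th): its th-derivative is i times the t-derivative
   of exp(i (a th + al)) exp(- Z e^(i th) t) t^a. *)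
Definition rotated_derivative (th t : R) : R :=
  expR (- (Z * cos th * t)) * t `^ (a - 1) *
  (Z * sin th * t * cos (a * th - Z * sin th * t + al) -
   (a - Z * cos th * t) * sin (a * th - Z * sin th * t + al)).

Lemma is_derive_rotated_gamma (th t : R) :
  is_derive th (1 : R) (rotated_gamma ^~ t) (rotated_derivative th t).
Proof.
rewrite /rotated_gamma.
apply: is_derive_eq.
rewrite /rotated_derivative /GRing.scale/=.
by ring.
Qed.

Lemma is_derive_rotated_primitive (th t : R) : 0 < t ->
  is_derive t (1 : R) (rotated_primitive th) (rotated_derivative th t).
Proof.
move=> t0; have dt := is_derive1_powR a t0.
rewrite /rotated_primitive.
apply: is_derive_eq.
rewrite /rotated_derivative /GRing.scale/=.
have -> : t `^ a = t * t `^ (a - 1).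
  rewrite -{2}(powRr1 (ltW t0)) -powRD; last by rewrite (gt_eqF t0) implybT.
  by congr (_ `^ _); ring.
by ring.
Qed.

Lemma integrable_damped (b p : R) (c : R -> R) : 0 < b -> 0 < p -> continuous c ->
  (forall t, `|c t| <= 1) ->
  mu.-integrable `]0%R, +oo[%classic
    (fun t : R => (expR (- (p * t)) * c t * t `^ (b - 1))%:E).
Proof.
move=> b0 p0 cc c1; apply: le_integrable (integrable_gamma b p b0 p0) => //.
  apply/measurable_EFinP; apply: continuous_itv0y_measurable => t.
  rewrite in_itv/= andbT => t0; apply: cvgM; last exact: continuous_powR.
  apply: cvgM; last exact: cc.
  apply: continuous_comp; last exact: continuous_expR.
  by apply: continuousN; apply: cvgM; [exact: cvg_cst|exact: cvg_id].
move=> t _; rewrite !abse_EFin lee_fin !normrM.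
by rewrite ler_wpM2r// ler_piMr.
Qed.

Lemma integrable_rotated_gamma (th : R) : 0 < cos th ->
  mu.-integrable `]0%R, +oo[%classic (EFin \o rotated_gamma th).
Proof.
move=> c0; apply: integrable_damped => //; first exact: mulr_gt0.
- move=> t; apply: continuous_comp; last exact: continuous_cos.
  apply: cvgD; last exact: cvg_cst.
  apply: cvgB; first exact: cvg_cst.
  by apply: cvgM; [exact: cvg_cst|exact: cvg_id].
- by move=> t; rewrite ler_norml cos_geN1 cos_le1.
Qed.

(** A majorant of the th-derivative that is uniform in th as long as p <= Z cos th, as
    differentiation under the integral requires. Each of the two trigonometric terms contributes Z
    t; [a + 1 - 1] displays a Gamma integrand of parameter a + 1. *)
Definition rotation_bound (p t : R) : R :=
  a * (expR (- (p * t)) * t `^ (a - 1)) +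
  2 * Z * (expR (- (p * t)) * t `^ (a + 1 - 1)).

Lemma rotation_bound_ge0 (p t : R) : 0 <= rotation_bound p t.
Proof.
rewrite addr_ge0// !mulr_ge0 ?expR_ge0 ?powR_ge0//; exact: ltW.
Qed.

Lemma integrable_rotation_bound (p : R) : 0 < p ->
  mu.-integrable `]0%R, +oo[%classic (EFin \o rotation_bound p).
Proof.
move=> p0; have a1 : 0 < a + 1 by rewrite addr_gt0.
have -> : EFin \o rotation_bound p = (fun t : R =>
    a%:E * (expR (- (p * t)) * t `^ (a - 1))%:E +
    (2 * Z)%:E * (expR (- (p * t)) * t `^ (a + 1 - 1))%:E)%E.
  by apply/funext => t.
by apply: integrableD => //; apply: integrableZl => //; exact: integrable_gamma.
Qed.

Lemma normr_rotated_derivative (p th t : R) : 0 < t -> p <= Z * cos th ->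
  `|rotated_derivative th t| <= rotation_bound p t.
Proof.
move=> t0 pc; rewrite /rotated_derivative /rotation_bound.
have -> : t `^ (a + 1 - 1) = t `^ (a - 1) * t.
  rewrite -{3}(powRr1 (ltW t0)) -powRD; last by rewrite (gt_eqF t0) implybT.
  by congr (_ `^ _); ring.
set P := t `^ (a - 1).
set C := cos (_ + _); set S := sin (_ + _).
have P0 : 0 <= P by exact: powR_ge0.
have leE : expR (- (Z * cos th * t)) <= expR (- (p * t)).
  by rewrite ler_expR lerN2 ler_wpM2r// ltW.
have -> : a * (expR (- (p * t)) * P) + 2 * Z * (expR (- (p * t)) * (P * t)) =
    expR (- (p * t)) * P * (a + 2 * Z * t) by ring.
rewrite !normrM (ger0_norm (expR_ge0 _)) (ger0_norm P0).
apply: ler_pM; rewrite ?mulr_ge0 ?expR_ge0//; first by rewrite ler_wpM2r.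
have Zt0 : 0 <= Z * t by rewrite mulr_ge0 ?ltW.
have C1 : `|C| <= 1 by rewrite ler_norml cos_geN1 cos_le1.
have S1 : `|S| <= 1 by rewrite ler_norml sin_geN1 sin_le1.
have c1 : `|cos th| <= 1 by rewrite ler_norml cos_geN1 cos_le1.
have s1 : `|sin th| <= 1 by rewrite ler_norml sin_geN1 sin_le1.
apply: (le_trans (ler_normB _ _)).
have h1 : `|Z * sin th * t * C| <= Z * t.
  have -> : Z * sin th * t * C = (Z * t) * (sin th * C) by ring.
  by rewrite normrM (ger0_norm Zt0) ler_piMr// normrM mulr_ile1.
have h2 : `|(a - Z * cos th * t) * S| <= a + Z * t.
  rewrite normrM -[leRHS]mulr1; apply: ler_pM => //.
  apply: (le_trans (ler_normB _ _)); rewrite (ger0_norm (ltW a0)) lerD2l.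
  have -> : Z * cos th * t = Z * t * cos th by ring.
  by rewrite normrM (ger0_norm Zt0) ler_piMr.
have -> : a + 2 * Z * t = Z * t + (a + Z * t) by ring.
exact: lerD.
Qed.

Lemma continuous_rotated_derivative (th t : R) : 0 < t ->
  {for t, continuous (rotated_derivative th)}.
Proof.
move=> t0; apply: differentiable_continuous; apply/derivable1_diffP.
have dt := is_derive1_powR (a - 1) t0.
rewrite /rotated_derivative.
apply: ex_derive.
Qed.

Lemma measurable_rotated_derivative (th : R) :
  measurable_fun (`]0%R, +oo[%classic : set R) (rotated_derivative th).
Proof.
apply: continuous_itv0y_measurable => t; rewrite in_itv/= andbT.
exact: continuous_rotated_derivative.
Qed.

Lemma integrable_rotated_derivative (th : R) : 0 < cos th ->
  mu.-integrable `]0%R, +oo[%classic (EFin \o rotated_derivative th).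
Proof.
move=> c0; have p0 : 0 < Z * cos th by exact: mulr_gt0.
apply: le_integrable (integrable_rotation_bound (Z * cos th) p0) => //.
  by apply/measurable_EFinP; exact: measurable_rotated_derivative.
move=> t; rewrite /= in_itv/= andbT => t0.
rewrite lee_fin (ger0_norm (rotation_bound_ge0 _ _)).
exact: normr_rotated_derivative.
Qed.

(** Dominated convergence of the truncations, with |f| as majorant, since f may change sign. *)
Lemma cvg_Rintegral_exhaust (u v : nat -> R) (f : R -> R) :
  (forall k, 0 < u k) -> u k @[k --> \oo] --> 0 -> v k @[k --> \oo] --> +oo ->
  mu.-integrable `]0%R, +oo[%classic (EFin \o f) ->
  \int[mu]_(t in `[u k, v k]) f t @[k --> \oo] --> \int[mu]_(t in `]0, +oo[) f t.
Proof.
move=> u0 cu cv intf.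
have mf := measurable_int _ intf.
have sub k : (`[u k, v k]%classic : set R) `<=` `]0%R, +oo[%classic.
  by move=> t/=; rewrite !in_itv/= andbT => /andP[+ _]; apply: lt_le_trans.
pose g k : R -> \bar R := (EFin \o f) \_ `[u k, v k]%classic.
have [|||||] := @dominated_convergence _ _ _ mu `]0%R, +oo[%classic (measurable_itv _) g
  (EFin \o f) (abse \o (EFin \o f)).
- move=> k; apply/measurable_restrict => //.
  by apply: measurable_funS mf => //; apply: subIset; left.
- exact: mf.
- apply: aeW => t; rewrite /= in_itv/= andbT => t0.
  apply: cvg_near_cst; near=> k; rewrite /g patchE ifT// inE/= in_itv/=.
  apply/andP; split.
    by near: k; apply: (cvgr_le 0).
  by near: k; move/cvgryPge : cv; exact.
- exact: integrable_abse.
- apply: aeW => t k t0; rewrite /g patchE; case: ifPn => //= _.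
  by rewrite lee_fin normr0.
move=> _ _ cvgg.
rewrite /Rintegral; apply: fine_cvg; rewrite fineK; last exact: integrable_fin_num.
move: cvgg; rewrite /g.
under eq_fun do rewrite -integral_mkcondr setIidr//.
exact.
Unshelve. all: by end_near. Qed.

(** The integral over [u k, v k] is the difference of the boundary values of [rotated_primitive],
    which vanish in the limit: at 0 through t^a with a > 0, at infinity through the exponential. *)
Lemma Rintegral_rotated_derivative (th : R) : 0 < cos th ->
  \int[mu]_(t in `]0, +oo[) rotated_derivative th t = 0.
Proof.
move=> c0; have p0 : 0 < Z * cos th by exact: mulr_gt0.
(* With k+2 rather than k+1, u k < v k is strict also for k = 0. *)
pose u k : R := k.+1%:R^-1; pose v k : R := k.+2%:R.
have u0 k : 0 < u k by rewrite invr_gt0.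
have cu : u k @[k --> \oo] --> (0 : R) by exact: cvg_harmonic.
have cv : v k @[k --> \oo] --> +oo.
  apply/cvgryPge => A; near=> k.
  apply: (@le_trans _ _ k%:R); last by rewrite ler_nat -addn2 leq_addr.
  by near: k; apply: nbhs_infty_ger; exact: num_real.
have uv k : u k < v k.
  by rewrite (@le_lt_trans _ _ 1)// ?invf_le1 ?ler1n// ltr1n.
have pos k t : t \in `[u k, v k]%R -> 0 < t.
  by rewrite in_itv/= => /andP[+ _]; exact: lt_le_trans.
have cF t : 0 < t -> {for t, continuous (rotated_primitive th)}.
  move=> t0; apply: differentiable_continuous; apply/derivable1_diffP.
  by have [] := is_derive_rotated_primitive th t t0.
have FTC k : \int[mu]_(t in `[u k, v k]) rotated_derivative th t =
    rotated_primitive th (v k) - rotated_primitive th (u k).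
  rewrite /Rintegral (@continuous_FTC2 _ _ (rotated_primitive th))//.
  - apply: continuous_in_subspaceT => t; rewrite inE => /pos t0.
    exact: continuous_rotated_derivative.
  - split => [t /subset_itv_oo_cc /pos t0||].
    + by have [] := is_derive_rotated_primitive th t t0.
    + by apply: cvg_at_right_filter; apply: cF; apply: (pos k); rewrite in_itv/= lexx ltW.
    + by apply: cvg_at_left_filter; apply: cF; apply: (pos k); rewrite in_itv/= lexx andbT ltW.
  - move=> t /subset_itv_oo_cc /pos t0; rewrite derive1E.
    by have [_ ->] := is_derive_rotated_primitive th t t0.
(* Exponent a + 1 leaves t^(-1) after multiplication by t^a. *)
have [C [C0 HC]] := expR_decay (a + 1) (Z * cos th) p0.
have bound t : 0 < t -> `|rotated_primitive th t| <= expR (- (Z * cos th * t)) * t `^ a.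
  move=> t0; rewrite /rotated_primitive normrN !normrM (ger0_norm (powR_ge0 _ _)).
  rewrite (ger0_norm (expR_ge0 _)) ler_wpM2r ?powR_ge0// ler_piMr ?expR_ge0//.
  by rewrite ler_norml sin_geN1 sin_le1.
have cu' : u k @[k --> \oo] --> 0^'+.
  move=> A [e /= e0 eA]; have /cvgrPdist_lt/(_ e e0) := cu.
  by apply: filterS => k /= ke; apply: eA => //; exact: u0.
have cFu : rotated_primitive th (u k) @[k --> \oo] --> 0.
  apply: norm_cvg0.
  apply: (@squeeze_cvgr _ _ _ _ (cst 0) (fun k => u k `^ a)).
  - near=> k; rewrite normr_ge0/=; apply: (le_trans (bound _ (u0 k))).
    rewrite ler_piMl ?powR_ge0// -expR0 ler_expR oppr_le0.
    by rewrite mulr_ge0// ltW.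
  - exact: cvg_cst.
  - exact: cvg_comp cu' (powR_cvg0 a0).
have cFv : rotated_primitive th (v k) @[k --> \oo] --> 0.
  apply: norm_cvg0.
  apply: (@squeeze_cvgr _ _ _ _ (cst 0) (fun k => C * u k)).
  - near=> k; rewrite normr_ge0/=.
    have v1 : 1 <= v k by rewrite ler1n.
    have v0 : 0 < v k by exact: lt_le_trans v1.
    apply: (le_trans (bound _ v0)).
    apply: (@le_trans _ _ (C * v k `^ (- (a + 1)) * v k `^ a)).
      by rewrite ler_wpM2r ?powR_ge0// HC.
    rewrite -mulrA ler_wpM2l ?(ltW C0)// -powRD; last by rewrite (gt_eqF v0) implybT.
    have -> : - (a + 1) + a = -1 by ring.
    rewrite powR_inv1 ?(ltW v0)// /u /v lef_pV2 ?posrE ?ltr0n// ler_nat.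
    exact: leqnSn.
  - exact: cvg_cst.
  - by rewrite -(mulr0 C); apply: cvgM => //; exact: cvg_cst.
have cint := cvg_Rintegral_exhaust u v _ u0 cu cv (integrable_rotated_derivative th c0).
have c00 : \int[mu]_(t in `[u k, v k]) rotated_derivative th t @[k --> \oo] --> (0 : R).
  by under eq_fun do rewrite FTC; rewrite -(subr0 0); exact: cvgB.
exact: (cvg_unique _ cint c00).
Unshelve. all: by end_near. Qed.

(** The integral has derivative 0 in th, so it equals its value at th = 0, a real Gamma integral
    times cos al. *)
Lemma Rintegral_rotated_gamma (th : R) : - (pi / 2) < th < pi / 2 ->
  \int[mu]_(t in `]0, +oo[) rotated_gamma th t = Z `^ (- a) * Gamma a * cos al.
Proof.
move=> thpi.
pose P th' := \int[mu]_(t in `]0, +oo[) rotated_gamma th' t.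
have pi20 : 0 < pi / 2 :> R by rewrite divr_gt0 ?pi_gt0.
(* Midway between |th| and pi/2: ]-b, b[ contains 0 and th, and cos >= cos b > 0 on it provides a
   single majorant. *)
pose b := (`|th| + pi / 2) / 2.
have thb : `|th| < pi / 2 by rewrite ltr_norml.
have bth : `|th| < b by rewrite /b; lra.
have bpi : b < pi / 2 by rewrite /b; lra.
have b0 : 0 < b by exact: le_lt_trans bth.
have cosb : 0 < cos b.
  by apply: cos_gt0_pihalf; rewrite bpi andbT (lt_trans _ b0)// oppr_lt0.
have cosI x : x \in `]- b, b[%R -> cos b <= cos x.
  rewrite in_itv/= -ltr_norml => xb.
  have -> : cos x = cos `|x|.
    by have [x0|x0] := leP 0 x; [rewrite ger0_norm|rewrite ltr0_norm// cosN].
  have pib : b <= pi by have := pi_gt0 R; lra.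
  by apply/ltW; rewrite ltr_cos// in_itv/= ?normr_ge0 ?(ltW b0)//= (le_trans (ltW xb)).
have bb : - b < b by lra.
have Pd x : x \in `]- b, b[%R -> is_derive x (1 : R) P 0.
  move=> xI.
  have i1 y : `]- b, b[%classic y -> mu.-integrable `]0%R, +oo[%classic (EFin \o rotated_gamma y).
    by move=> yI; apply: integrable_rotated_gamma; apply: lt_le_trans cosb _; exact: cosI.
  have d1 y t : `]- b, b[%classic y -> `]0%R, +oo[%classic t -> derivable (rotated_gamma ^~ t) y 1.
    by move=> _ _; have [] := is_derive_rotated_gamma y t.
  have pE y t : partial1of2 rotated_gamma y t = rotated_derivative y t.
    by rewrite partial1of2E; have [_ ->] := is_derive_rotated_gamma y t.
  have G1 y t : `]- b, b[%classic y -> `]0%R, +oo[%classic t ->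
      `|partial1of2 rotated_gamma y t| <= rotation_bound (Z * cos b) t.
    move=> yI; rewrite /= in_itv/= andbT => t0; rewrite pE.
    by apply: normr_rotated_derivative => //; rewrite ler_pM2l// cosI.
  have G0 := rotation_bound_ge0 (Z * cos b).
  have iG := integrable_rotation_bound _ (mulr_gt0 Z0 cosb).
  have mI : measurable (`]0%R, +oo[%classic : set (measurableTypeR R)).
    exact: measurable_itv.
  have dP := derivable_under_integral mI xI i1 d1 G0 iG G1.
  have dE := differentiation_under_integral mI xI i1 d1 G0 iG G1.
  apply: DeriveDef => //; rewrite -derive1E dE.
  under eq_Rintegral do rewrite pE.
  apply: Rintegral_rotated_derivative; apply: lt_le_trans cosb _; exact: cosI.
have Pcst x y : x \in `]- b, b[%R -> y \in `]- b, b[%R -> x < y -> P x = P y.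
  move=> xI yI xy.
  have sub t : t \in `[x, y]%R -> t \in `]- b, b[%R.
    move: xI yI; rewrite !in_itv/= => /andP[h1 _] /andP[_ h2] /andP[h3 h4].
    by rewrite (lt_le_trans h1)// (le_lt_trans h4).
  have dPxy t : t \in `]x, y[%R -> is_derive t (1 : R) P (cst 0 t).
    by move=> /subset_itv_oo_cc /sub /Pd.
  have [|c _ /eqP] := MVT xy dPxy.
    by apply: derivable_within_continuous => t /sub /Pd [].
  by rewrite mul0r subr_eq0 => /eqP.
have thI : th \in `]- b, b[%R by rewrite in_itv/= -ltr_norml.
have I0 : 0 \in `]- b, b[%R by rewrite in_itv/= oppr_lt0 b0.
have -> : \int[mu]_(t in `]0, +oo[) rotated_gamma th t = P 0.
  by have [h|h|->//] := ltgtP th 0; [exact: Pcst|apply/esym/Pcst].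
rewrite /P -(Rintegral_gamma a Z a0 Z0) mulrC -RintegralZl//; last exact: integrable_gamma.
apply: eq_Rintegral => t _; rewrite /rotated_gamma cos0 sin0.
by rewrite !mulr1 !mulr0 mul0r subr0 add0r; ring.
Qed.

End gamma_rotation.

Section complex_gamma.
Context {R : realType}.
Notation mu := (@lebesgue_measure R).
Variables (a Z th : R).
Hypotheses (a0 : 0 < a) (Z0 : 0 < Z) (thpi : - (pi / 2) < th < pi / 2).

(** The phase al = - a th cancels the rotation factor in the integrand and reappears in the
    value. *)
Lemma Rintegral_gamma_cos :
  \int[mu]_(t in `]0, +oo[) (expR (- (Z * cos th * t)) * cos (Z * sin th * t) * t `^ (a - 1))
  = Z `^ (- a) * Gamma a * cos (a * th).
Proof.
rewrite -[cos (a * th)]cosN -(Rintegral_rotated_gamma a Z (- (a * th)) a0 Z0 th thpi).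
apply: eq_Rintegral => t _; rewrite /rotated_gamma -[cos (Z * sin th * t)]cosN.
by congr (_ * cos _ * _); ring.
Qed.

(** As for the cosine, with the phase shifted by pi/2. *)
Lemma Rintegral_gamma_sin :
  \int[mu]_(t in `]0, +oo[) (expR (- (Z * cos th * t)) * sin (Z * sin th * t) * t `^ (a - 1))
  = Z `^ (- a) * Gamma a * sin (a * th).
Proof.
have sE (x : R) : sin x = cos (- x + pi / 2) by rewrite cosDpihalf sinN opprK.
rewrite [sin (a * th)]sE -(Rintegral_rotated_gamma a Z (- (a * th) + pi / 2) a0 Z0 th thpi).
apply: eq_Rintegral => t _; rewrite /rotated_gamma sE.
by congr (_ * cos _ * _); ring.
Qed.

End complex_gamma.

(** * Integrals of homogeneous functions *)

Section homogeneous_integrals.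
Context {R : realType} {n : nat}.
Local Notation V := 'rV[R]_n.+1.
Notation mu := (@lebesgue_measure R).
Variables (nu lambda : R) (S0 : sphere R n -> R).
Hypotheses (nu_gt0 : 0 < nu) (mS0 : measurable_fun setT S0)
  (S0_gt0 : forall xi, 0 < S0 xi).
Local Notation N := (n.+1%:R : R).
Local Notation a := (lambda / nu).
Local Notation T0 := (homogeneous_ext nu S0).
Local Notation F g := (homogeneous_ext (lambda - N) g).

Lemma measurable_fun_powR d (T : measurableType d) (D : set T) (h : T -> R) (b : R) :
  measurable_fun D h -> measurable_fun D (fun x => h x `^ b).
Proof. by move=> mh; exact: (measurableT_comp (measurable_powR b) mh). Qed.

Lemma homogeneous_ext_neq0 (b : R) (g : sphere R n -> R) (x : V) : x != 0 ->
  homogeneous_ext b g x = enorm x `^ b * g (dir x).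
Proof. by rewrite /homogeneous_ext => /negbTE ->. Qed.

Lemma homogeneous_ext0 (b : R) (g : sphere R n -> R) : homogeneous_ext b g (0 : V) = 0.
Proof. by rewrite /homogeneous_ext eqxx. Qed.

Lemma measurable_homogeneous_ext (b : R) (g : sphere R n -> R) :
  measurable_fun setT g -> measurable_fun setT (homogeneous_ext b g : V -> R).
Proof.
move=> mg.
(* The indicator encodes the value 0 at the origin, where the power alone would give 1 if b = 0. *)
have -> : homogeneous_ext b g = (fun x : V =>
    \1_(`]0, +oo[%classic) (enorm x) * (enorm x `^ b * g (dir x))).
  apply/funext => x; rewrite indicE; have [->|x0] := eqVneq x 0.
    by rewrite homogeneous_ext0 enorm0 memNset ?mul0r//= in_itv/= ltxx.
  by rewrite homogeneous_ext_neq0// mem_set ?mul1r//= in_itv/= enorm_gt0 x0.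
apply: measurable_funM.
  by apply: (measurableT_comp (measurable_indic _)) => //; exact: measurable_enorm.
apply: measurable_funM.
  by apply: measurable_fun_powR; exact: measurable_enorm.
by apply: measurableT_comp => //; exact: measurable_dir.
Qed.

Lemma surface_measure_fin (E : set (sphere R n)) :
  measurable E -> (surface_measure E < +oo)%E.
Proof.
move=> mE; rewrite /surface_measure/= /mscale/=.
by rewrite lte_mul_pinfty// -ge0_fin_numE// cone_volume_fin_num.
Qed.

(** With t = |x|^N, the phase is S0(xi) t^(nu/N) and the amplitude g(xi) t^(lambda/N - 1). The power
    substitution gives S0^(-a) and the factor N/nu, whose N turns cone volume into surface
    measure. *)
Lemma ge0_integral_homogeneous (phi : R -> R) (g : sphere R n -> R) :
  {in `]0, +oo[%R, continuous phi} -> (forall t : R, 0 < t -> 0 <= phi t) ->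
  mu.-integrable `]0%R, +oo[%classic (fun t : R => (phi t * t `^ (a - 1))%:E) ->
  measurable_fun setT g -> (forall xi, 0 <= g xi) ->
  (\int[lebesgue_n]_x (phi (T0 x) * F g x)%:E =
  ((\int[mu]_(t in `]0%R, +oo[) (phi t * t `^ (a - 1))) / nu)%:E *
   \int[surface_measure]_xi (g xi / S0 xi `^ a)%:E)%E.
Proof.
move=> cphi phi0 iphi mg g0.
pose al := nu / N; pose be := lambda / N.
have N0 : 0 < N by rewrite ltr0n.
have al0 : 0 < al by rewrite divr_gt0.
have bal : be / al = a.
  by rewrite /be /al invf_div mulrA mulfVK// gt_eqF.
(* phi is controlled on t > 0 only; its extension by 0 is measurable and nonnegative on the whole
   line. *)
pose ps := phi \_ `]0%R, +oo[%classic.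
have mps : measurable_fun (setT : set R) ps.
  apply/(measurable_restrict _ _ _).1 => //.
  by rewrite setTI; exact: continuous_itv0y_measurable.
have ps0 t : 0 <= ps t.
  by rewrite /ps patchE; case: ifPn => //; rewrite inE/= in_itv/= andbT => /phi0.
pose k (p : measurableTypeR R * sphere R n) :=
  (ps (S0 p.2 * p.1 `^ al) * (p.1 `^ (be - 1) * g p.2) * \1_(`]0%R, +oo[%classic) p.1)%:E.
have mk : measurable_fun setT k.
  apply/measurable_EFinP; apply: measurable_funM; last first.
    by apply: measurableT_comp; [exact: measurable_indic|exact: measurable_fst].
  apply: measurable_funM.
    apply: measurableT_comp => //; apply: measurable_funM.
      by apply: measurableT_comp => //; exact: measurable_snd.
    by apply: measurable_fun_powR; exact: measurable_fst.
  apply: measurable_funM.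
    by apply: measurable_fun_powR; exact: measurable_fst.
  by apply: measurableT_comp => //; exact: measurable_snd.
have k0 p : (0 <= k p)%E by rewrite lee_fin !mulr_ge0 ?powR_ge0.
transitivity (\int[lebesgue_n]_x k (polar_coord x))%E.
  apply: eq_integral => x _; rewrite /k /polar_coord/=; congr EFin; rewrite indicE.
  have [->|x0] := eqVneq x 0.
    rewrite !homogeneous_ext0 mulr0 enorm0 expr0n/= memNset ?mulr0//=.
    by rewrite in_itv/= ltxx.
  have e0 : 0 < enorm x by rewrite enorm_gt0.
  rewrite mem_set ?mulr1; last by rewrite /= in_itv/= andbT exprn_gt0.
  rewrite !homogeneous_ext_neq0// -powR_mulrn ?(ltW e0)// -!powRrM.
  have -> : N * al = nu by rewrite /al mulrCA divff ?mulr1// gt_eqF.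
  have -> : N * (be - 1) = lambda - N.
    by rewrite mulrBr mulr1 /be mulrCA divff ?mulr1// gt_eqF.
  rewrite /ps patchE ifT ?[S0 _ * _]mulrC//.
  by rewrite inE/= in_itv/= andbT mulr_gt0// powR_gt0.
rewrite ge0_integral_polar//.
have mI : measurable (`]0%R, +oo[%classic : set (measurableTypeR R)).
  exact: measurable_itv.
have Ifin := integrable_fin_num mI iphi.
transitivity (\int[@cone_volume R n]_xi
   ((N * ((\int[mu]_(t in `]0%R, +oo[) (phi t * t `^ (a - 1))) / nu))%:E *
    (g xi / S0 xi `^ a)%:E))%E.
  apply: eq_integral => xi _.
  transitivity (\int[mu]_(t in `]0%R, +oo[)
     ((g xi)%:E * (phi (S0 xi * t `^ al) * t `^ (be - 1))%:E))%E.
    apply: eq_integral => t; rewrite inE => t0; rewrite /k/= indicE mem_set// mulr1 -EFinM.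
    congr EFin; rewrite /ps patchE ifT; last first.
      move: t0; rewrite inE/= !in_itv/= !andbT => t0.
      by rewrite mulr_gt0// powR_gt0.
    by ring.
  have cps : {in `]0, +oo[%R, continuous (fun t => phi (S0 xi * t `^ al) * t `^ (be - 1))}.
    move=> t; rewrite in_itv/= andbT => t0; apply: cvgM; last exact: continuous_powR.
    apply: (@continuous_comp _ _ _ (fun x => S0 xi * x `^ al) phi).
      by apply: cvgM; [exact: cvg_cst|exact: continuous_powR].
    by apply: cphi; rewrite in_itv/= andbT mulr_gt0 ?powR_gt0.
  rewrite ge0_integralZl_EFin//; last 2 first.
  - move=> t; rewrite /= in_itv/= andbT => t0.
    by rewrite lee_fin mulr_ge0 ?powR_ge0// phi0// mulr_gt0 ?powR_gt0.
  - by apply/measurable_EFinP; exact: continuous_itv0y_measurable.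
  rewrite (ge0_integral_gamma_subst (S0 xi) al be phi)// bal.
  rewrite -(fineK Ifin) -!EFinM; congr EFin.
  rewrite /Rintegral /al powRN invf_div.
  by field; rewrite !gt_eqF ?powR_gt0.
have I0 : 0 <= \int[mu]_(t in `]0%R, +oo[) (phi t * t `^ (a - 1)).
  apply: Rintegral_ge0 => t; rewrite /= in_itv/= andbT => t0.
  by rewrite mulr_ge0 ?powR_ge0 ?phi0.
have mgS : measurable_fun setT (fun xi => (g xi / S0 xi `^ a)%:E).
  apply/measurable_EFinP; apply: measurable_funM; first exact: mg.
  under eq_fun do rewrite -powRN.
  by apply: measurable_fun_powR; exact: mS0.
have gS0 xi : (0 <= (g xi / S0 xi `^ a)%:E)%E.
  by rewrite lee_fin divr_ge0 ?powR_ge0.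
rewrite ge0_integralZl_EFin//; last first.
  by rewrite mulr_ge0 ?ler0n// divr_ge0// ltW.
rewrite /surface_measure ge0_integral_mscale//= EFinM -muleA muleCA.
by [].
Qed.

Variables (m : R).
Hypotheses (lambda_gt0 : 0 < lambda) (m_gt0 : 0 < m) (mleS0 : forall xi, m <= S0 xi).

Let a_gt0 : 0 < a. Proof. exact: divr_gt0. Qed.

Lemma integrable_sphere_ratio (g : sphere R n -> R) (M : R) :
  measurable_fun setT g -> (forall xi, `|g xi| <= M) ->
  surface_measure.-integrable setT (fun xi => (g xi / S0 xi `^ a)%:E).
Proof.
move=> mg gM.
apply: (@measurable_bounded_integrable _ _ _ _ (fun xi => g xi / S0 xi `^ a)).
- exact: measurableT.
- by apply: surface_measure_fin; exact: measurableT.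
- apply: measurable_funM; first exact: mg.
  under eq_fun do rewrite -powRN.
  by apply: measurable_fun_powR; exact: mS0.
exists (M / m `^ a); split; first exact: num_real.
move=> M' MM' xi _ /=; apply: le_trans (ltW MM').
rewrite normrM; apply: ler_pM => //.
rewrite ger0_norm ?invr_ge0 ?powR_ge0// lef_pV2 ?posrE ?powR_gt0//.
by apply: ge0_ler_powR; rewrite ?nnegrE ?(ltW a_gt0)// ltW.
Qed.

Lemma measurable_homogeneous (phi : R -> R) (g : sphere R n -> R) :
  {in `]0, +oo[%R, continuous phi} -> measurable_fun setT g ->
  measurable_fun setT (fun x => phi (T0 x) * F g x).
Proof.
move=> cphi mg.
have -> : (fun x => phi (T0 x) * F g x) =
    (fun x => (phi \_ `]0%R, +oo[%classic) (T0 x) * F g x).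
  apply/funext => x; have [->|x0] := eqVneq x 0; first by rewrite !homogeneous_ext0 !mulr0.
  rewrite patchE ifT// inE/= in_itv/= andbT homogeneous_ext_neq0//.
  by rewrite mulr_gt0 ?powR_gt0 ?enorm_gt0.
apply: measurable_funM; last exact: measurable_homogeneous_ext.
apply: measurableT_comp; last exact: measurable_homogeneous_ext.
apply/(measurable_restrict _ _ _).1 => //.
by rewrite setTI; exact: continuous_itv0y_measurable.
Qed.

(** Integrability is part of the predicate so that it passes to differences in phi and in g. *)
Definition homogeneous_formula (phi : R -> R) (g : sphere R n -> R) :=
  lebesgue_n.-integrable setT (fun x => (phi (T0 x) * F g x)%:E) /\
  \int[lebesgue_n]_x (phi (T0 x) * F g x) =
  (\int[mu]_(t in `]0, +oo[) (phi t * t `^ (a - 1))) / nu *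
   \int[surface_measure]_xi (g xi / S0 xi `^ a).

Let phi_integrable (phi : R -> R) :=
  mu.-integrable `]0%R, +oo[%classic (fun t : R => (phi t * t `^ (a - 1))%:E).

Lemma ge0_homogeneous_formula (phi : R -> R) (g : sphere R n -> R) (M : R) :
  {in `]0, +oo[%R, continuous phi} -> (forall t : R, 0 < t -> 0 <= phi t) ->
  phi_integrable phi ->
  measurable_fun setT g -> (forall xi, 0 <= g xi) -> (forall xi, `|g xi| <= M) ->
  homogeneous_formula phi g.
Proof.
move=> cphi phi0 iphi mg g0 gM.
have E := ge0_integral_homogeneous phi g cphi phi0 iphi mg g0.
have iK := integrable_sphere_ratio g M mg gM.
have Kfin := integrable_fin_num measurableT iK.
split; last by rewrite /Rintegral E fineM.
apply/integrableP; split; first by apply/measurable_EFinP; exact: measurable_homogeneous.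
rewrite (_ : (\int[lebesgue_n]_x `|(phi (T0 x) * F g x)%:E| =
    \int[lebesgue_n]_x (phi (T0 x) * F g x)%:E)%E).
  by rewrite E -(fineK Kfin) -EFinM ltry.
apply: eq_integral => x _; rewrite gee0_abs// lee_fin.
have [->|x0] := eqVneq x 0; first by rewrite !homogeneous_ext0 mulr0.
rewrite !homogeneous_ext_neq0// mulr_ge0 ?mulr_ge0 ?powR_ge0// phi0//.
by rewrite mulr_gt0 ?powR_gt0 ?enorm_gt0.
Qed.

Lemma homogeneous_formula_subl (phi1 phi2 : R -> R) (g : sphere R n -> R) :
  phi_integrable phi1 -> phi_integrable phi2 ->
  homogeneous_formula phi1 g -> homogeneous_formula phi2 g ->
  homogeneous_formula (fun t => phi1 t - phi2 t) g.
Proof.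
move=> i1 i2 [I1 E1] [I2 E2]; split.
  under eq_fun do rewrite mulrBl EFinB.
  exact: integrableB.
under eq_Rintegral do rewrite mulrBl.
rewrite RintegralB// E1 E2.
under [in RHS]eq_Rintegral do rewrite mulrBl.
by rewrite RintegralB//; ring.
Qed.

Lemma homogeneous_formula_subr (phi : R -> R) (g1 g2 : sphere R n -> R) (M : R) :
  measurable_fun setT g1 -> (forall xi, `|g1 xi| <= M) ->
  measurable_fun setT g2 -> (forall xi, `|g2 xi| <= M) ->
  homogeneous_formula phi g1 -> homogeneous_formula phi g2 ->
  homogeneous_formula phi (fun xi => g1 xi - g2 xi).
Proof.
move=> mg1 g1M mg2 g2M [I1 E1] [I2 E2].
have FB x : F (fun xi => g1 xi - g2 xi) x = F g1 x - F g2 x.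
  by rewrite /homogeneous_ext; case: ifP; rewrite ?subr0// mulrBr.
split.
  under eq_fun do rewrite FB mulrBr EFinB.
  exact: integrableB.
under eq_Rintegral do rewrite FB mulrBr.
rewrite RintegralB// E1 E2 -mulrBr; congr (_ * _).
rewrite -RintegralB; [|exact: measurableT|exact: integrable_sphere_ratio g1M
  |exact: integrable_sphere_ratio g2M].
by apply: eq_Rintegral => xi _; rewrite mulrBl.
Qed.

(** The formula is linear in phi and in g, and phi = (phi + |phi|) - |phi|, g = (g + M) - M are
    differences of nonnegative functions. *)
Lemma bounded_homogeneous_formula (phi : R -> R) (g : sphere R n -> R) (M : R) :
  {in `]0, +oo[%R, continuous phi} -> phi_integrable phi ->
  measurable_fun setT g -> (forall xi, `|g xi| <= M) ->
  homogeneous_formula phi g.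
Proof.
move=> cphi iphi mg gM.
have M0 : 0 <= M by exact: le_trans (normr_ge0 _) (gM (sphere_pt R n)).
have -> : phi = (fun t => (phi t + `|phi t|) - `|phi t|).
  by apply/funext => t; rewrite addrK.
have -> : g = (fun xi => (g xi + M) - cst M xi).
  by apply/funext => xi; rewrite addrK.
have cabs : {in `]0, +oo[%R, continuous (fun t => `|phi t|)}.
  by move=> t t0; apply: continuous_comp; [exact: cphi|exact: norm_continuous].
have cadd : {in `]0, +oo[%R, continuous (fun t => phi t + `|phi t|)}.
  by move=> t t0; apply: cvgD; [exact: cphi|exact: cabs].
have iabs : phi_integrable (fun t => `|phi t|).
  have := integrable_abse iphi; apply: eq_integrable => // t _.
  by rewrite /= normrM (ger0_norm (powR_ge0 _ _)).
have iadd : phi_integrable (fun t => phi t + `|phi t|).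
  have mI : measurable (`]0%R, +oo[%classic : set (measurableTypeR R)).
    exact: measurable_itv.
  have := integrableD mI iphi iabs; apply: eq_integrable => // t _.
  by rewrite /= mulrDl EFinD.
have add0 t : 0 < t -> 0 <= phi t + `|phi t|.
  by move=> _; have := ler_norm (- phi t); rewrite normrN; lra.
have g1M xi : `|g xi + M| <= M + M.
  by apply: (le_trans (ler_normD _ _)); rewrite lerD// ger0_norm.
have g10 xi : 0 <= g xi + M.
  by have := gM xi; rewrite ler_norml => /andP[+ _]; rewrite -subr_ge0 opprK addrC.
have mg1 : measurable_fun setT (fun xi => g xi + M) by exact: measurable_funD.
have g2M xi : `|cst M xi| <= M + M by rewrite ger0_norm//= lerDl.
have mg2 : measurable_fun setT (cst M : sphere R n -> R) by exact: measurable_cst.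
have main (psi : R -> R) : {in `]0, +oo[%R, continuous psi} ->
    (forall t : R, 0 < t -> 0 <= psi t) ->
    phi_integrable psi -> homogeneous_formula psi (fun xi => (g xi + M) - cst M xi).
  move=> cpsi psi0 ipsi.
  apply: (homogeneous_formula_subr psi _ _ (M + M)) => //.
    exact: (ge0_homogeneous_formula psi _ (M + M)).
  exact: (ge0_homogeneous_formula psi _ (M + M)).
apply: homogeneous_formula_subl => //; exact: main.
Qed.

End homogeneous_integrals.

(** * Error estimates *)

Section integral_estimates.
Context d (T : measurableType d) (R : realType) (mu : {measure set T -> \bar R}).

Lemma normr_Rintegral_le (D : set T) (h g : T -> R) : measurable D ->
  measurable_fun D h -> mu.-integrable D (EFin \o g) ->
  (forall x, D x -> `|h x| <= g x) ->
  mu.-integrable D (EFin \o h) /\ `|\int[mu]_(x in D) h x| <= \int[mu]_(x in D) g x.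
Proof.
move=> mD mh ig hg.
have ih : mu.-integrable D (EFin \o h).
  apply: le_integrable ig => //; first exact/measurable_EFinP.
  move=> x Dx; rewrite !abse_EFin lee_fin; apply: le_trans (hg x Dx) _.
  exact: ler_norm.
split => //; apply: le_trans (le_normr_Rintegral mD ih) _.
apply: le_Rintegral => //.
have := integrable_abse ih; apply: eq_integrable => // x _.
Qed.

Lemma Rintegral_subset_le (A B : set T) (g : T -> R) : measurable A -> measurable B ->
  mu.-integrable B (EFin \o g) -> (forall x, B x -> 0 <= g x) -> A `<=` B ->
  \int[mu]_(x in A) g x <= \int[mu]_(x in B) g x.
Proof.
move=> mA mB ig g0 AB; have igA := integrableS mB mA AB ig.
apply: fine_le; [exact: integrable_fin_num|exact: integrable_fin_num|].
by apply: ge0_subset_integral => //; exact: measurable_int ig.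
Qed.

Lemma Rintegral_setD (D E : set T) (h : T -> R) : measurable D -> measurable E ->
  E `<=` D -> mu.-integrable D (EFin \o h) ->
  \int[mu]_(x in D) h x = \int[mu]_(x in E) h x + \int[mu]_(x in D `\` E) h x.
Proof.
move=> mD mE ED ih; rewrite -[in LHS](setDUK ED) Rintegral_setU//.
- exact: measurableD.
- by rewrite setDUK.
- by apply/disj_setPS => x [Ex []].
Qed.

(** A lives on D and B on the whole space: they are compared on E, and their tails on D \ E and
    outside E are bounded separately. *)
Lemma Rintegral_diff_le (D E : set T) (A B g1 g2 g3 : T -> R) (e1 e2 e3 : R) :
  measurable D -> measurable E -> E `<=` D ->
  mu.-integrable D (EFin \o A) -> mu.-integrable setT (EFin \o B) ->
  mu.-integrable E (EFin \o g1) -> mu.-integrable (D `\` E) (EFin \o g2) ->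
  mu.-integrable (~` E) (EFin \o g3) ->
  (forall x, E x -> `|A x - B x| <= g1 x) ->
  (forall x, (D `\` E) x -> `|A x| <= g2 x) ->
  (forall x, (~` E) x -> `|B x| <= g3 x) ->
  \int[mu]_(x in E) g1 x <= e1 -> \int[mu]_(x in D `\` E) g2 x <= e2 ->
  \int[mu]_(x in ~` E) g3 x <= e3 ->
  `|\int[mu]_(x in D) A x - \int[mu]_x B x| <= e1 + e2 + e3.
Proof.
move=> mD mE ED iA iB i1 i2 i3 h1 h2 h3 l1 l2 l3.
have mDE : measurable (D `\` E) by exact: measurableD.
have mCE : measurable (~` E) by exact: measurableC.
have iAE := integrableS mD mE ED iA.
have iADE := integrableS mD mDE (@subDsetl _ D E) iA.
have iBE := integrableS measurableT mE (@subsetT _ E) iB.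
have iBC := integrableS measurableT mCE (@subsetT _ (~` E)) iB.
rewrite (Rintegral_setD D E)// (Rintegral_setD setT E)// setTD.
have -> : \int[mu]_(x in E) A x + \int[mu]_(x in D `\` E) A x -
   (\int[mu]_(x in E) B x + \int[mu]_(x in ~` E) B x) =
   \int[mu]_(x in E) (A x - B x) + \int[mu]_(x in D `\` E) A x - \int[mu]_(x in ~` E) B x.
  by rewrite RintegralB//; ring.
have mm A' (h : T -> R) : mu.-integrable A' (EFin \o h) -> measurable_fun A' h.
  by move=> /measurable_int /measurable_EFinP.
have mAB : measurable_fun E (fun x => A x - B x) by apply: measurable_funB; exact: mm.
have [_ b1] := normr_Rintegral_le E _ g1 mE mAB i1 h1.
have [_ b2] := normr_Rintegral_le (D `\` E) _ g2 mDE (mm _ _ iADE) i2 h2.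
have [_ b3] := normr_Rintegral_le (~` E) _ g3 mCE (mm _ _ iBC) i3 h3.
apply: (le_trans (ler_normB _ _)); apply: lerD; last exact: le_trans b3 l3.
apply: (le_trans (ler_normD _ _)).
by apply: lerD; [exact: le_trans b1 l1|exact: le_trans b2 l2].
Qed.

End integral_estimates.

Section elementary_estimates.
Context {R : realType}.

Lemma lipschitz_derive (h dh : R -> R) : (forall x : R, is_derive x (1 : R) h (dh x)) ->
  (forall x, `|dh x| <= 1) -> forall x y, `|h x - h y| <= `|x - y|.
Proof.
move=> hd dh1; have main x y : x < y -> `|h y - h x| <= `|y - x|.
  move=> xy; have [|c _ ->] := MVT xy (fun x _ => hd x).
    by apply: derivable_within_continuous => t _; have [] := hd t.
  by rewrite normrM ler_piMl.
move=> x y; have [xy|xy|->] := ltgtP x y; last by rewrite !subrr normr0.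
  by rewrite distrC [leRHS]distrC; exact: main.
exact: main.
Qed.

Lemma lipschitz_cos (x y : R) : `|cos x - cos y| <= `|x - y|.
Proof.
apply: (@lipschitz_derive cos (fun t => - sin t)) => t.
by rewrite normrN ler_norml sin_geN1 sin_le1.
Qed.

Lemma lipschitz_sin (x y : R) : `|sin x - sin y| <= `|x - y|.
Proof.
apply: (@lipschitz_derive sin cos) => t.
by rewrite ler_norml cos_geN1 cos_le1.
Qed.

(** For u <= v, factor out exp(-u) and use 1 - exp(-(v - u)) <= v - u. *)
Lemma normr_expR_sub (x y z : R) : z <= x -> z <= y ->
  `|expR (- x) - expR (- y)| <= expR (- z) * `|x - y|.
Proof.
have main u v : z <= u -> u <= v -> `|expR (- u) - expR (- v)| <= expR (- z) * `|u - v|.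
  move=> zu uv.
  rewrite ger0_norm; last by rewrite subr_ge0 ler_expR lerN2.
  rewrite distrC ger0_norm ?subr_ge0//.
  apply: (@le_trans _ _ (expR (- u) * (v - u))); last first.
    by rewrite ler_wpM2r ?subr_ge0// ler_expR lerN2.
  have -> : expR (- v) = expR (- u) * expR (- (v - u)).
    by rewrite -expRD; congr expR; ring.
  rewrite -[X in X - _]mulr1 -mulrBr ler_wpM2l ?expR_ge0//.
  by have := expR_ge1Dx (- (v - u)); lra.
move=> zx zy; have [xy|/ltW yx] := leP x y; first exact: main.
by rewrite distrC [`|x - y|]distrC; exact: main.
Qed.

(** This bounds the tails: sg is an exponent at which the integral is finite, J its value there, and
    c a lower bound of the phase away from 0. *)
Lemma expR_small (a sg c J ka eta : R) : 0 < c -> 0 < ka -> 0 <= J -> 0 < eta ->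
  exists2 r : R, 1 <= r & forall Z, r <= Z ->
    expR (- ((ka * Z - sg) * c)) * J <= eta * Z `^ (- a).
Proof.
move=> c0 ka0 J0 eta0.
(* Decay of order a + 1 leaves a factor 1/Z beyond Z^(-a), and Z >= D / eta absorbs D. *)
have [C [C0 HC]] := expR_decay (a + 1) (ka * c) (mulr_gt0 ka0 c0).
pose D := expR (sg * c) * J * C.
have D0 : 0 <= D by rewrite !mulr_ge0 ?expR_ge0// ltW.
exists (1 + D / eta); first by rewrite lerDl divr_ge0// ltW.
move=> Z rZ; have Z1 : 1 <= Z.
  by apply: le_trans rZ; rewrite lerDl divr_ge0// ltW.
have Z0 : 0 < Z by exact: lt_le_trans Z1.
have -> : expR (- ((ka * Z - sg) * c)) = expR (sg * c) * expR (- (ka * c * Z)).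
  by rewrite -expRD; congr expR; ring.
apply: (@le_trans _ _ (expR (sg * c) * (C * Z `^ (- (a + 1))) * J)).
  by rewrite ler_wpM2r// ler_wpM2l ?expR_ge0// HC.
have -> : Z `^ (- (a + 1)) = Z `^ (- a) * Z^-1.
  rewrite -[Z^-1]powR_inv1 ?(ltW Z0)// -powRD; last by rewrite (gt_eqF Z0) implybT.
  by congr (_ `^ _); ring.
have -> : expR (sg * c) * (C * (Z `^ (- a) * Z^-1)) * J = D * Z^-1 * Z `^ (- a).
  by rewrite /D; ring.
rewrite ler_wpM2r ?powR_ge0// ler_pdivrMr// mulrC -ler_pdivrMr//.
by apply: le_trans rZ; rewrite lerDr.
Qed.

End elementary_estimates.

Section local_behaviour.
Context {R : realType} {n : nat}.
Local Notation V := 'rV[R]_n.+1.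

(** Uniformity in the direction is what allows one radius e for all x. *)
Lemma asymp_at0_homogeneous (D : set V) (g : V -> R) (b : R) (h : sphere R n -> R) :
  asymp_at0 D g b h -> forall eta, 0 < eta -> exists2 e : R, 0 < e &
    forall x, x != 0 -> enorm x < e -> D x ->
      `|g x - homogeneous_ext b h x| <= eta * enorm x `^ b.
Proof.
move=> gh eta /gh [e /= e0 He]; exists e => // x x0 xe Dx.
have ex0 : 0 < enorm x by rewrite enorm_gt0.
have xE : x = enorm x *: val (dir x).
  by rewrite val_dir// scalerA divff ?scale1r// gt_eqF.
have := He (enorm x); rewrite /ball_/= sub0r normrN ger0_norm ?(ltW ex0)//.
move=> /(_ xe ex0 (dir x)); rewrite -xE => /(_ Dx).
by rewrite homogeneous_ext_neq0.
Qed.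

Lemma interior_eball (D : set V) : D° 0 -> exists2 e : R, 0 < e & eball e `<=` D.
Proof.
move=> /nbhs_ballP[e /= e0 eD]; exists e => // x xe; apply: eD; split => // i j.
rewrite (ord1 i) mxE /ball/= sub0r normrN.
exact: le_lt_trans (normr_coord_le_enorm x j) xe.
Qed.

(** In polar coordinates the origin is the preimage of {0} times the sphere, and [lebesgue_pos] does
    not charge 0. *)
Lemma lebesgue_n_set0 : lebesgue_n [set 0 : V] = 0%E.
Proof.
have -> : [set 0 : V] = polar_coord @^-1` ([set 0] `*` setT).
  apply/seteqP; split => [x ->|x [/= /eqP + _]].
    by split => //=; rewrite enorm0 expr0n.
  by rewrite expf_eq0/= => /eqP /enorm_eq0.
rewrite lebesgue_n_polar_rectangle//.
rewrite /lebesgue_pos /mrestr (_ : _ `&` _ = set0) ?measure0 ?mul0e//.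
by apply/seteqP; split => // t [-> /=]; rewrite in_itv/= ltxx.
Qed.

End local_behaviour.

(** * Comparison with the homogeneous model *)

Section laplace_asymptotics.
Context {R : realType}.
Notation mu := (@lebesgue_measure R).

Lemma integral_gamma_affine (a b D : R) : 0 < a -> 0 < b ->
  mu.-integrable `]0%R, +oo[%classic
    (fun t : R => (expR (- (b * t)) * (1 + D * t) * t `^ (a - 1))%:E) /\
  \int[mu]_(t in `]0, +oo[) (expR (- (b * t)) * (1 + D * t) * t `^ (a - 1)) =
  b `^ (- a) * Gamma a + D * (b `^ (- (a + 1)) * Gamma (a + 1)).
Proof.
move=> a0 b0; have a1 : 0 < a + 1 by rewrite addr_gt0.
have mI : measurable (`]0%R, +oo[%classic : set (measurableTypeR R)).
  exact: measurable_itv.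
have i1 := integrable_gamma a b a0 b0.
have i2 := integrableZl mI D (integrable_gamma (a + 1) b a1 b0).
have E t : t \in (`]0%R, +oo[%classic : set R) ->
    expR (- (b * t)) * (1 + D * t) * t `^ (a - 1) =
    expR (- (b * t)) * t `^ (a - 1) + D * (expR (- (b * t)) * t `^ (a + 1 - 1)).
  rewrite inE/= in_itv/= andbT => t0.
  have -> : t `^ (a + 1 - 1) = t * t `^ (a - 1).
    rewrite -{2}(powRr1 (ltW t0)) -powRD; last by rewrite (gt_eqF t0) implybT.
    by congr (_ `^ _); ring.
  by ring.
split.
  have := integrableD mI i1 i2; apply: eq_integrable => // t t0.
  by rewrite (E t t0) EFinD EFinM.
transitivity (\int[mu]_(t in `]0, +oo[) (expR (- (b * t)) * t `^ (a - 1) +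
    D * (expR (- (b * t)) * t `^ (a + 1 - 1)))); first exact: eq_Rintegral.
rewrite RintegralD// RintegralZl//; last exact: integrable_gamma.
by rewrite !Rintegral_gamma.
Qed.

(** Here w is |x|^nu and fr is |x|^(lambda - N). The amplitude, the oscillating factor and the
    exponential are replaced in turn; each of the last two costs eta Z w M fr. As eta <= m/2, both
    phases are at least (m/2) w, whence the damping ka m/2. *)
Lemma laplace_pointwise (c : R -> R) (ka m M Z p q eta w fr Sx Tx fx Fx : R) :
  (forall x, `|c x| <= 1) -> (forall x y, `|c x - c y| <= `|x - y|) ->
  0 < ka -> 0 < m -> 0 < Z -> ka * Z <= p -> p <= Z -> `|q| <= Z ->
  0 <= w -> 0 <= eta -> eta <= m / 2 ->
  `|Sx - Tx| <= eta * w -> `|fx - Fx| <= eta * fr ->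
  m * w <= Tx -> `|Fx| <= M * fr ->
  `|expR (- (p * Sx)) * c (q * Sx) * fx - expR (- (p * Tx)) * c (q * Tx) * Fx| <=
  eta * (expR (- (ka * m / 2 * Z * w)) * (1 + 2 * M * Z * w) * fr).
Proof.
move=> c1 cL ka0 m0 Z0 kp pZ qZ w0 eta0 etam ST fF mT FM.
set y := ka * m / 2 * Z * w.
have p0 : 0 <= p by apply: le_trans kp; rewrite mulr_ge0 ?ltW.
have Sw : m / 2 * w <= Sx.
  have etaw : eta * w <= m / 2 * w by rewrite ler_wpM2r.
  by move: ST; rewrite ler_norml => /andP[+ _]; lra.
have Tw : m / 2 * w <= Tx.
  by apply: le_trans mT; rewrite ler_wpM2r//; lra.
have mw0 : 0 <= m / 2 * w by rewrite mulr_ge0// divr_ge0// ltW.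
have yE : y = ka * Z * (m / 2 * w) by rewrite /y; ring.
have kZ0 : 0 <= ka * Z by rewrite mulr_ge0 ?ltW.
have yS : y <= p * Sx by rewrite yE; apply: ler_pM.
have yT : y <= p * Tx by rewrite yE; apply: ler_pM.
have eS : expR (- (p * Sx)) <= expR (- y) by rewrite ler_expR lerN2.
have -> : expR (- (p * Sx)) * c (q * Sx) * fx - expR (- (p * Tx)) * c (q * Tx) * Fx =
  expR (- (p * Sx)) * (c (q * Sx) * (fx - Fx)) +
  expR (- (p * Sx)) * ((c (q * Sx) - c (q * Tx)) * Fx) +
  (expR (- (p * Sx)) - expR (- (p * Tx))) * (c (q * Tx) * Fx) by ring.
have -> : eta * (expR (- y) * (1 + 2 * M * Z * w) * fr) =
  expR (- y) * (1 * (eta * fr)) + expR (- y) * ((Z * (eta * w)) * (M * fr)) +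
  (expR (- y) * (Z * (eta * w))) * (1 * (M * fr)) by ring.
have qST : `|q * Sx - q * Tx| <= Z * (eta * w).
  by rewrite -mulrBr normrM; apply: ler_pM.
have pST : `|p * Sx - p * Tx| <= Z * (eta * w).
  by rewrite -mulrBr normrM (ger0_norm p0); apply: ler_pM.
apply: (le_trans (ler_normD _ _)); apply: lerD.
  apply: (le_trans (ler_normD _ _)); apply: lerD.
    rewrite !normrM (ger0_norm (expR_ge0 _)); apply: ler_pM => //.
    exact: ler_pM.
  rewrite !normrM (ger0_norm (expR_ge0 _)); apply: ler_pM => //.
  by apply: ler_pM => //; exact: le_trans (cL _ _) qST.
rewrite !normrM; apply: ler_pM => //; last exact: ler_pM.
apply: (le_trans (normr_expR_sub _ _ y yS yT)).
by rewrite ler_wpM2l ?expR_ge0.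
Qed.

Context {n : nat}.
Local Notation V := 'rV[R]_n.+1.
Local Notation N := (n.+1%:R : R).
Variables (Omega : set V) (f S : V -> R) (nu lambda sigma0 : R)
  (S0 f0 : sphere R n -> R) (m M : R).
Hypotheses (mOmega : measurable Omega) (Omega0 : Omega° 0)
  (mf : measurable_fun Omega f) (mS : measurable_fun Omega S)
  (S_lbound : forall eps : R, 0 < eps ->
    exists2 c : R, 0 < c & forall x, Omega x -> ~ eball eps x -> c <= S x)
  (nu_gt0 : 0 < nu) (mS0 : measurable_fun setT S0)
  (m_gt0 : 0 < m) (mleS0 : forall xi, m <= S0 xi)
  (S_asymp : asymp_at0 Omega S nu S0) (lambda_gt0 : 0 < lambda)
  (f0M : forall xi, `|f0 xi| <= M) (mf0 : measurable_fun setT f0)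
  (f_asymp : asymp_at0 Omega f (lambda - N) f0)
  (f_int : (\int[lebesgue_n]_(x in Omega)
    (expR (- sigma0 * S x) * `|f x|)%:E < +oo)%E)
  (f00 : f 0 = 0).
Local Notation a := (lambda / nu).
Local Notation T0 := (homogeneous_ext nu S0).
Local Notation F0 := (homogeneous_ext (lambda - N) f0).

Let S0_gt0 xi : 0 < S0 xi. Proof. exact: lt_le_trans (mleS0 xi). Qed.

Let a_pos : 0 < a. Proof. exact: divr_gt0. Qed.

Lemma integrable_laplace_majorant : lebesgue_n.-integrable Omega
  (EFin \o (fun x => expR (- sigma0 * S x) * `|f x|)).
Proof.
apply/integrableP; split.
  apply/measurable_EFinP; apply: measurable_funM.
    apply: measurableT_comp; first exact: measurable_expR.
    by apply: measurable_funM; [exact: measurable_cst|exact: mS].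
  by apply: measurableT_comp; [exact: normr_measurable|exact: mf].
move: f_int; congr (_ < _)%E; apply: eq_integral => x _.
by rewrite gee0_abs// lee_fin mulr_ge0 ?expR_ge0.
Qed.

(** x lies outside the open ball of its own radius |x|. *)
Lemma S_ge0 x : Omega x -> x != 0 -> 0 <= S x.
Proof.
move=> Ox x0; have ex0 : 0 < enorm x by rewrite enorm_gt0.
have [c c0 Hc] := S_lbound _ ex0.
by apply: le_trans (ltW c0) (Hc _ Ox _); rewrite /eball/= ltxx.
Qed.

Lemma homogeneous_damped (p q : R) (c : R -> R) : 0 < p -> continuous c ->
  (forall x, `|c x| <= 1) ->
  homogeneous_formula nu lambda S0 (fun t => expR (- (p * t)) * c (q * t)) f0.
Proof.
move=> p0 cc c1.
have ccq : continuous (fun t => c (q * t)).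
  move=> t; apply: continuous_comp; last exact: cc.
  by apply: cvgM; [exact: cvg_cst|exact: cvg_id].
apply: (bounded_homogeneous_formula nu lambda S0 nu_gt0 mS0 S0_gt0 m lambda_gt0
  m_gt0 mleS0 _ f0 M) => //.
- move=> t _; apply: cvgM; last exact: ccq.
  apply: continuous_comp; last exact: continuous_expR.
  by apply: continuousN; apply: cvgM; [exact: cvg_cst|exact: cvg_id].
- by apply: integrable_damped => // t.
Qed.

Lemma laplace_error (c : R -> R) (ka eta : R) : continuous c ->
  (forall x, `|c x| <= 1) -> (forall x y, `|c x - c y| <= `|x - y|) ->
  0 < ka -> 0 < eta ->
  exists2 r : R, 0 < r & forall Z p q, r <= Z -> ka * Z <= p -> p <= Z -> `|q| <= Z ->
    lebesgue_n.-integrable Omega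
      (EFin \o (fun x => expR (- (p * S x)) * c (q * S x) * f x)) /\
    `|\int[lebesgue_n]_(x in Omega) (expR (- (p * S x)) * c (q * S x) * f x) -
      \int[lebesgue_n]_x (expR (- (p * T0 x)) * c (q * T0 x) * F0 x)| <=
    eta * Z `^ (- a).
Proof.
move=> cc c1 cL ka0 eta0.
have M0 : 0 <= M by exact: le_trans (normr_ge0 _) (f0M (sphere_pt R n)).
pose beta := ka * m / 2.
have beta0 : 0 < beta by rewrite !mulr_gt0// invr_gt0.
(* With [one] for both angular functions the homogeneous extensions are the pure powers of |x|, and
   [C1] will be the integral of the majorant near 0, up to the factor Z^(-a). *)
pose one : sphere R n -> R := cst 1.
pose K1 := \int[surface_measure]_xi (one xi / one xi `^ a).
have K10 : 0 <= K1.
  by apply: Rintegral_ge0 => xi _; rewrite divr_ge0 ?powR_ge0.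
pose C1 := (beta `^ (- a) * Gamma a +
  2 * M * (beta `^ (- (a + 1)) * Gamma (a + 1))) / nu * K1.
have C10 : 0 <= C1.
  rewrite mulr_ge0// mulr_ge0 ?invr_ge0 ?(ltW nu_gt0)//.
  by rewrite addr_ge0// !mulr_ge0 ?powR_ge0 ?Gamma_ge0.
pose eta3 := eta / 3.
have eta30 : 0 < eta3 by rewrite divr_gt0.
(* m/2 is what [laplace_pointwise] requires; the other bound gives eta1 C1 <= eta/3, with C1 + 1
   because C1 may be 0. *)
pose eta1 := Num.min (m / 2) (eta3 / (C1 + 1)).
have eta10 : 0 < eta1.
  by rewrite lt_min !divr_gt0// ltr_wpDl.
have eta1m : eta1 <= m / 2 by rewrite ge_min lexx.
have eta1C : eta1 * C1 <= eta3.
  apply: (@le_trans _ _ (eta3 / (C1 + 1) * (C1 + 1))).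
    by apply: ler_pM; rewrite ?(ltW eta10)//; [rewrite ge_min lexx orbT|rewrite lerDl].
  by rewrite mulfVK// gt_eqF// ltr_wpDl.
have [e1 e10 He1] := asymp_at0_homogeneous _ _ _ _ S_asymp _ eta10.
have [e2 e20 He2] := asymp_at0_homogeneous _ _ _ _ f_asymp _ eta10.
have [e3 e30 He3] := interior_eball _ Omega0.
pose e := Num.min e1 (Num.min e2 e3).
have e0 : 0 < e by rewrite !lt_min e10 e20.
pose E : set V := eball e.
have mE : measurable E by exact: measurable_eball.
have EO : E `<=` Omega.
  by move=> x; rewrite /E/eball/= !lt_min => /andP[_ /andP[_ /He3]].
have [c0 c00 Hc0] := S_lbound _ e0.
pose d0 := m * e `^ nu.
have d00 : 0 < d0 by rewrite mulr_gt0 ?powR_gt0.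
have T0E x : ~ E x -> d0 <= T0 x.
  move=> nEx; have ex : e <= enorm x by rewrite leNgt; apply/negP.
  have x0 : x != 0 by rewrite -enorm_gt0 (lt_le_trans e0).
  rewrite homogeneous_ext_neq0// mulrC; apply: ler_pM => //; rewrite ?powR_ge0 ?(ltW m_gt0)//.
  by apply: ge0_ler_powR; rewrite ?nnegrE ?(ltW nu_gt0) ?enorm_ge0 ?(ltW e0).
pose J := \int[lebesgue_n]_(x in Omega) (expR (- sigma0 * S x) * `|f x|).
have J0 : 0 <= J by apply: Rintegral_ge0 => x _; rewrite mulr_ge0 ?expR_ge0.
have iJ := integrable_laplace_majorant.
have iJ2 : lebesgue_n.-integrable setT (EFin \o (fun x => expR (- T0 x) * `|F0 x|)).
  have n1 : forall x : R, `|cst 1 x| <= 1 :> R by move=> x; rewrite normr1.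
  have [+ _] := homogeneous_damped 1 0 (cst 1) ltr01 (fun t => cvg_cst _) n1.
  move=> /integrable_abse; apply: eq_integrable => // x _.
  by rewrite /= mul1r mulr1 normrM (ger0_norm (expR_ge0 _)).
pose J2 := \int[lebesgue_n]_x (expR (- T0 x) * `|F0 x|).
have J20 : 0 <= J2 by apply: Rintegral_ge0 => x _; rewrite mulr_ge0 ?expR_ge0.
(* The tail of the integral is compared with its value at the exponent sigma0, that of the model
   with its value at the exponent 1. *)
have [r1 r11 Hr1] := expR_small a sigma0 c0 J ka eta3 c00 ka0 J0 eta30.
have [r2 r21 Hr2] := expR_small a 1 d0 J2 ka eta3 d00 ka0 J20 eta30.
(* The last two thresholds ensure p >= sigma0 and p >= 1. *)
exists (Num.max (Num.max r1 r2) (Num.max (sigma0 / ka) ka^-1)).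
  by rewrite !lt_max (lt_le_trans ltr01 r11).
move=> Z p q; rewrite !ge_max => /andP[/andP[Zr1 Zr2] /andP[Zs Zk]] kp pZ qZ.
have Z0 : 0 < Z by apply: lt_le_trans Zr1; exact: lt_le_trans r11.
have ps : sigma0 <= p by apply: le_trans kp; rewrite mulrC -ler_pdivrMr.
have p1 : 1 <= p by apply: le_trans kp; rewrite mulrC -ler_pdivrMr// mul1r.
have p0 : 0 < p by exact: lt_le_trans p1.
pose A x := expR (- (p * S x)) * c (q * S x) * f x.
have mA : measurable_fun Omega A.
  apply: measurable_funM; last exact: mf.
  apply: measurable_funM.
    apply: measurableT_comp; first exact: measurable_expR.
    apply: measurableT_comp; first exact: oppr_measurable.
    by apply: measurable_funM; [exact: measurable_cst|exact: mS].
  apply: (@measurableT_comp _ _ _ _ _ _ c); first exact: continuous_measurable_fun.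
  by apply: measurable_funM; [exact: measurable_cst|exact: mS].
have AleS x (s : R) : Omega x -> s <= S x -> 0 <= s ->
    `|A x| <= expR (- ((p - sigma0) * s)) * (expR (- sigma0 * S x) * `|f x|).
  move=> Ox sS s0; rewrite /A !normrM (ger0_norm (expR_ge0 _)) mulrA.
  rewrite ler_wpM2r//; apply: (@le_trans _ _ (expR (- (p * S x)))).
    by rewrite ler_piMr ?expR_ge0.
  rewrite -expRD ler_expR.
  have : (p - sigma0) * s <= (p - sigma0) * S x by rewrite ler_wpM2l// subr_ge0.
  by lra.
have Ale x : Omega x -> `|A x| <= expR (- sigma0 * S x) * `|f x|.
  (* S may be negative at the origin, where the integrand vanishes by [f00]. *)
  move=> Ox; have [->|x0] := eqVneq x 0; first by rewrite /A f00 mulr0 normr0 mulr0.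
  have := AleS x 0 Ox (S_ge0 x Ox x0) (lexx 0).
  by rewrite mulr0 oppr0 expR0 mul1r.
have [iA _] := normr_Rintegral_le _ _ _ lebesgue_n Omega A _ mOmega mA iJ Ale.
have [iB _] := homogeneous_damped p q c p0 cc c1.
split; first exact: iA.
pose b := beta * Z.
have b0 : 0 < b by rewrite mulr_gt0.
pose phi t := expR (- (b * t)) * (1 + 2 * M * Z * t).
pose T1 : V -> R := homogeneous_ext nu one.
pose F1 : V -> R := homogeneous_ext (lambda - N) one.
have [iphi phiE] := integral_gamma_affine a b (2 * M * Z) a_pos b0.
have [i1 I1] : homogeneous_formula nu lambda one phi one.
  apply: (bounded_homogeneous_formula nu lambda one nu_gt0 (measurable_cst _)
    (fun=> ltr01) 1 lambda_gt0 ltr01 (fun=> lexx 1) phi one 1) => //.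
  - move=> t _; apply: cvgM.
      apply: continuous_comp; last exact: continuous_expR.
      by apply: continuousN; apply: cvgM; [exact: cvg_cst|exact: cvg_id].
    apply: cvgD; first exact: cvg_cst.
    by apply: cvgM; [exact: cvg_cst|exact: cvg_id].
  - by move=> xi; rewrite normr1.
have {}I1 : \int[lebesgue_n]_x (phi (T1 x) * F1 x) = C1 * Z `^ (- a).
  rewrite I1 phiE -/K1 /C1 /b.
  rewrite !(@powRM _ beta Z) ?(ltW beta0) ?(ltW Z0)//.
  have -> : Z `^ (- (a + 1)) = Z `^ (- a) * Z^-1.
    rewrite -[Z^-1]powR_inv1 ?(ltW Z0)// -powRD; last by rewrite (gt_eqF Z0) implybT.
    by congr (_ `^ _); ring.
  by field; rewrite !gt_eqF.
(* g1 bounds the difference inside the ball. Off the ball S >= c0 and T0 >= d0, so g2 and g3 take an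
   exponentially small factor out of exp(-pS) and exp(-p T0). *)
pose g1 x := eta1 * (phi (T1 x) * F1 x).
pose g2 x := expR (- ((ka * Z - sigma0) * c0)) * (expR (- sigma0 * S x) * `|f x|).
pose g3 x := expR (- ((ka * Z - 1) * d0)) * (expR (- T0 x) * `|F0 x|).
have phi0 x : 0 <= phi (T1 x) * F1 x.
  have T10 : 0 <= T1 x.
    by rewrite /T1 /homogeneous_ext; case: ifP => // _; rewrite mulr_ge0 ?powR_ge0.
  rewrite /phi !mulr_ge0 ?expR_ge0 ?addr_ge0 ?mulr_ge0 ?(ltW Z0)//.
  by rewrite /F1 /homogeneous_ext; case: ifP => // _; rewrite mulr_ge0 ?powR_ge0.
have ig1 : lebesgue_n.-integrable setT (EFin \o g1) by exact: integrableZl i1.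
have ig2 : lebesgue_n.-integrable Omega (EFin \o g2) by exact: integrableZl iJ.
have ig3 : lebesgue_n.-integrable setT (EFin \o g3) by exact: integrableZl iJ2.
have etaE : eta * Z `^ (- a) = eta3 * Z `^ (- a) + eta3 * Z `^ (- a) + eta3 * Z `^ (- a).
  by rewrite /eta3; field.
rewrite etaE.
have mOE : measurable (Omega `\` E) by exact: measurableD.
have mCE : measurable (~` E) by exact: measurableC.
apply: (@Rintegral_diff_le _ _ _ lebesgue_n Omega E A _ g1 g2 g3) => //.
- exact: integrableS ig1.
- by apply: integrableS ig2 => //; exact: subDsetl.
- exact: integrableS ig3.
- move=> x Ex; have [->|x0] := eqVneq x 0.
    by rewrite /A f00 !homogeneous_ext0 !mulr0 subrr normr0 mulr_ge0// ltW.
  have Ox := EO _ Ex.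
  move: (Ex); rewrite /E /eball/= !lt_min => /andP[xe1 /andP[xe2 _]].
  rewrite /g1 /phi /T1 /F1 !(homogeneous_ext_neq0 _ one)// !mulr1.
  apply: (laplace_pointwise c ka m M Z p q) => //.
  + exact: powR_ge0.
  + exact: ltW.
  + exact: He1.
  + exact: He2.
  + by rewrite homogeneous_ext_neq0// mulrC ler_wpM2l ?powR_ge0.
  + rewrite homogeneous_ext_neq0// normrM (ger0_norm (powR_ge0 _ _)) mulrC.
    by rewrite ler_wpM2r ?powR_ge0.
- move=> x [Ox nEx]; apply: (le_trans (AleS x c0 Ox (Hc0 _ Ox nEx) (ltW c00))).
  rewrite ler_wpM2r ?mulr_ge0 ?expR_ge0// ler_expR lerN2 ler_wpM2r ?(ltW c00)//.
  by rewrite lerB.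
- move=> x nEx; rewrite /g3 !normrM (ger0_norm (expR_ge0 _)) mulrA ler_wpM2r//.
  apply: (@le_trans _ _ (expR (- (p * T0 x)))); first by rewrite ler_piMr ?expR_ge0.
  rewrite -expRD ler_expR.
  have h1 : (ka * Z - 1) * d0 <= (p - 1) * d0 by rewrite ler_wpM2r ?(ltW d00)// lerB.
  have h2 : (p - 1) * d0 <= (p - 1) * T0 x by rewrite ler_wpM2l ?subr_ge0// T0E.
  by lra.
- apply: (@le_trans _ _ (\int[lebesgue_n]_x g1 x)).
    by apply: Rintegral_subset_le => // x _; rewrite mulr_ge0// ltW.
  by rewrite RintegralZl// I1 mulrA ler_wpM2r ?powR_ge0.
- apply: (@le_trans _ _ (\int[lebesgue_n]_(x in Omega) g2 x)).
    by apply: Rintegral_subset_le => // x _; rewrite !mulr_ge0 ?expR_ge0.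
  by rewrite RintegralZl//; exact: Hr1.
- apply: (@le_trans _ _ (\int[lebesgue_n]_x g3 x)).
    by apply: Rintegral_subset_le => // x _; rewrite !mulr_ge0 ?expR_ge0.
  by rewrite RintegralZl//; exact: Hr2.
Qed.

End laplace_asymptotics.

(** * The asymptotic expansion *)

Section complex_arguments.
Context {R : realType}.
Implicit Types z : R[i].

Lemma normc_ReIm_le z : normc z <= `|complex.Re z| + `|complex.Im z|.
Proof.
case: z => x y /=; rewrite -[leRHS]ger0_norm ?addr_ge0// -sqrtr_sqr ler_wsqrtr//.
by rewrite sqrrD !real_normK ?num_real// -addrA lerD2l lerDr mulrn_wge0// mulr_ge0.
Qed.

(** sin(acos u) is sqrt(1 - u^2) = |y/r|, and the sign chosen in [carg] restores the sign of y. *)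
Lemma polar_carg z : 0 < normc z ->
  complex.Re z = normc z * cos (carg z) /\ complex.Im z = normc z * sin (carg z).
Proof.
case: z => x y; set r := normc _ => r0.
have rE : r ^+ 2 = x ^+ 2 + y ^+ 2 by rewrite /r/= sqr_sqrtr// addr_ge0// sqr_ge0.
have rn0 : r != 0 by rewrite gt_eqF.
pose u := x / r.
have u2 : u ^+ 2 + (y / r) ^+ 2 = 1 by rewrite !expr_div_n -mulrDl -rE divff// expf_neq0.
have u1 : -1 <= u <= 1.
  rewrite -ler_norml -(@ler_pXn2r _ 2%N)// ?nnegrE// expr1n real_normK ?num_real//.
  by rewrite -u2 lerDl sqr_ge0.
have sE : sin (acos u) = `|y / r|.
  by rewrite sin_acos// -u2 [X in X - _]addrC addrK sqrtr_sqr.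
have xr : x = r * u by rewrite /u mulrCA divff ?mulr1.
rewrite /carg -/r /= -/u; case: ifPn => y0.
  rewrite acosK// sE ger0_norm ?divr_ge0 ?(ltW r0)//; split => //.
  by rewrite mulrCA divff ?mulr1.
rewrite cosN sinN acosK// sE; split => //.
rewrite -ltNge in y0; rewrite normrM (gtr0_norm (x := r^-1)) ?invr_gt0// ltr0_norm//.
by field.
Qed.

Lemma cpow_realE z (a : R) : 0 < normc z ->
  cpow z (- a)%:C =
  (normc z `^ (- a) * cos (a * carg z)) +i* (- (normc z `^ (- a) * sin (a * carg z))).
Proof.
move=> z0; rewrite /cpow /clog /cexp /=.
have -> : - a * ln (normc z) - 0 * carg z = - a * ln (normc z) by rewrite mul0r subr0.
have -> : - a * carg z + 0 * ln (normc z) = - (a * carg z) by rewrite mul0r addr0 mulNr.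
rewrite cosN sinN mulrN; congr (_ +i* - _);
  by congr (_ * _); rewrite /powR gt_eqF.
Qed.

End complex_arguments.

Theorem theoremA2 (R : realType) (n : nat) (Omega : set 'rV[R]_n.+1)
    (f S : 'rV[R]_n.+1 -> R) (nu lambda sigma0 : R) (S0 f0 : sphere R n -> R)
    (mOmega : measurable Omega) (Omega0 : Omega° 0)
    (mf : measurable_fun Omega f) (mS : measurable_fun Omega S)
    (S_lbound : forall eps : R, 0 < eps ->
      exists2 c : R, 0 < c & forall x, Omega x -> ~ eball eps x -> c <= S x)
    (nu_gt0 : 0 < nu) (cS0 : continuous S0) (S0_gt0 : forall xi, 0 < S0 xi)
    (S_asymp : asymp_at0 Omega S nu S0)
    (lambda_gt0 : 0 < lambda)
    (bf0 : exists M : R, forall xi, `|f0 xi| <= M)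
    (mf0 : measurable_fun setT f0)
    (f_asymp : asymp_at0 Omega f (lambda - n.+1%:R) f0)
    (sigma0_gt0 : 0 < sigma0)
    (f_int : (\int[lebesgue_n]_(x in Omega)
      (expR (- sigma0 * S x) * `|f x|)%:E < +oo)%E) :
  let F0 := homogeneous_ext (lambda - n.+1%:R) f0 in
  let T0 := homogeneous_ext nu S0 in
  let integrand (z : R[i]) (x : 'rV[R]_n.+1) :=
    cexp (- z * (S x)%:C) * (f x)%:C in
  [/\ lebesgue_n.-integrable setT (fun x => (expR (- T0 x) * F0 x)%:E),
      surface_measure.-integrable setT
        (fun xi => (f0 xi / S0 xi `^ (lambda / nu))%:E),
      forall delta : R, 0 < delta -> delta <= pi / 2 ->
        forall eta : R, 0 < eta ->
        exists2 r : R, 0 < r & forall z : R[i],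
          r <= normc z -> `|carg z| <= pi / 2 - delta ->
          cintegrable lebesgue_n Omega (integrand z) /\
          normc (cintegral lebesgue_n Omega (integrand z)
                 - cpow z (- (lambda / nu))%:C
                   * (\int[lebesgue_n]_x (expR (- T0 x) * F0 x))%:C)
            <= eta * normc z `^ (- (lambda / nu))
    & \int[lebesgue_n]_x (expR (- T0 x) * F0 x)
      = Gamma (lambda / nu) / nu
        * \int[surface_measure]_xi (f0 xi / S0 xi `^ (lambda / nu))].
Proof.
move=> F0 T0 integrand.
have mS0 := measurable_continuous_sphere S0 cS0.
have [m m0 mS0'] := continuous_sphere_lbound S0 cS0 S0_gt0.
have [M f0M] := bf0.
set a := lambda / nu.
have a0 : 0 < a by exact: divr_gt0.
have damped := homogeneous_damped nu lambda S0 f0 m M nu_gt0 mS0 m0 mS0' lambda_gt0 f0M mf0.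
have n1 : forall x : R, `|cst 1 x| <= 1 :> R by move=> x; rewrite normr1.
(* p = 1, q = 0, c = 1 is the case phi(t) = exp(-t), which gives the constant. *)
have [iTF TF] := damped 1 0 (cst 1) ltr01 (fun t => cvg_cst _) n1.
pose K := \int[surface_measure]_xi (f0 xi / S0 xi `^ a).
have intE : \int[lebesgue_n]_x (expR (- T0 x) * F0 x) = Gamma a / nu * K.
  transitivity (\int[lebesgue_n]_x (expR (- (1 * T0 x)) * cst 1 (0 * T0 x) * F0 x)).
    by apply: eq_Rintegral => x _; rewrite mul1r mulr1.
  rewrite TF -/K GammaE; congr (_ / _ * _).
  by apply: eq_Rintegral => t _; rewrite mul1r mulr1.
split => //.
- by move: iTF; apply: eq_integrable => // x _; rewrite mul1r mulr1.
- exact: (integrable_sphere_ratio nu lambda S0 nu_gt0 mS0 S0_gt0 m lambda_gt0 m0 mS0' f0 M).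
move=> delta delta0 deltapi eta eta0.
(* The value of f at the origin is unconstrained: it is replaced by 0. *)
pose g x := if x == 0 then 0 else f x.
have gE x : x != 0 -> g x = f x by rewrite /g => /negbTE ->.
have m00 : measurable [set 0 : 'rV[R]_n.+1].
  rewrite -[X in measurable X]setCK; apply: measurableC.
  apply: open_measurable_rV; rewrite openE => x /eqP x0.
  have := near_rV_neq0 x x0; apply: filterS => y /eqP; exact.
have mOm0 : measurable (Omega `\ 0) by exact: measurableD.
have mg : measurable_fun Omega g.
  have -> : g = (fun x => f x * \1_([set~ 0]) x).
    apply/funext => x; rewrite indicE; have [->|x0] := eqVneq x 0.
      by rewrite /g eqxx memNset ?mulr0//=; apply.
    by rewrite gE// mem_set ?mulr1//=; apply/eqP.
  apply: measurable_funM; first exact: mf.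
  by apply: measurable_funTS; apply: measurable_indic; exact: measurableC.
have g_asymp : asymp_at0 Omega g (lambda - n.+1%:R) f0.
  move=> e /f_asymp; apply: filterS2 (nbhs_right_gt 0) => rho rho0 H xi Oxi.
  rewrite gE; first exact: H.
  rewrite -enorm_gt0 enormZ gtr0_norm//; have -> : enorm (val xi) = 1 := set_valP xi.
  by rewrite mulr1.
have g_int : (\int[lebesgue_n]_(x in Omega)
    (expR (- sigma0 * S x) * `|g x|)%:E < +oo)%E.
  apply: le_lt_trans f_int; apply: ge0_le_integral => //.
  - apply/measurable_EFinP; apply: measurable_funM.
      apply: measurableT_comp; first exact: measurable_expR.
      by apply: measurable_funM; [exact: measurable_cst|exact: mS].
    by apply: measurableT_comp; [exact: normr_measurable|exact: mg].
  - apply/measurable_EFinP; apply: measurable_funM.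
      apply: measurableT_comp; first exact: measurable_expR.
      by apply: measurable_funM; [exact: measurable_cst|exact: mS].
    by apply: measurableT_comp; [exact: normr_measurable|exact: mf].
  - move=> x _; rewrite lee_fin ler_wpM2l ?expR_ge0// /g.
    by case: ifP => // _; rewrite normr0.
have g0 : g 0 = 0 by rewrite /g eqxx.
have err := laplace_error Omega g S nu lambda sigma0 S0 f0 m M mOmega Omega0 mg mS
  S_lbound nu_gt0 mS0 m0 mS0' S_asymp lambda_gt0 f0M mf0 g_asymp g_int g0.
(* f and g differ at most on the null set {0}. *)
have transfer (h : 'rV[R]_n.+1 -> R) : measurable_fun Omega h ->
    lebesgue_n.-integrable Omega (EFin \o (fun x => h x * g x)) ->
    lebesgue_n.-integrable Omega (EFin \o (fun x => h x * f x)) /\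
    \int[lebesgue_n]_(x in Omega) (h x * f x) = \int[lebesgue_n]_(x in Omega) (h x * g x).
  move=> mh ig.
  have Efg : {in Omega `\ 0, (EFin \o (fun x => h x * g x)) =1 (EFin \o (fun x => h x * f x))}.
    by move=> x /[!inE] -[_ /eqP x0]; rewrite /= gE.
  have mhf : measurable_fun Omega (EFin \o (fun x => h x * f x)).
    by apply/measurable_EFinP; apply: measurable_funM; [exact: mh|exact: mf].
  have ihf : lebesgue_n.-integrable Omega (EFin \o (fun x => h x * f x)).
    apply/(negligible_integrable m00 mOmega mhf (lebesgue_n_set0)).
    apply: (eq_integrable mOm0 _ _ Efg).
    by apply: integrableS ig => //; exact: subDsetl.
  split => //; rewrite /Rintegral; congr fine.
  rewrite (negligible_integral m00 mOmega ihf lebesgue_n_set0).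
  rewrite (negligible_integral m00 mOmega ig lebesgue_n_set0).
  by apply: eq_integral => x /Efg.
(* The least value of cos th in the sector, so that Re z >= ka |z|. *)
pose ka := cos (pi / 2 - delta).
have ka0 : 0 < ka.
  by apply: cos_gt0_pihalf; apply/andP; split; have := pi_gt0 R; lra.
have cos1 (x : R) : `|cos x| <= 1 by rewrite ler_norml cos_geN1 cos_le1.
have sin1 (x : R) : `|sin x| <= 1 by rewrite ler_norml sin_geN1 sin_le1.
have eta20 : 0 < eta / 2 by rewrite divr_gt0.
have [r1 r10 Hc] := err cos ka (eta / 2) (@continuous_cos R) cos1 lipschitz_cos ka0 eta20.
have [r2 r20 Hs] := err sin ka (eta / 2) (@continuous_sin R) sin1 lipschitz_sin ka0 eta20.
exists (Num.max r1 r2); first by rewrite lt_max r10.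
move=> z; rewrite ge_max => /andP[zr1 zr2] zdelta.
set Z := normc z in zr1 zr2 *.
have Z0 : 0 < Z by exact: lt_le_trans zr1.
set th := carg z in zdelta.
have [zRe zIm] := polar_carg z Z0; rewrite -/Z -/th in zRe zIm.
have thpi : - (pi / 2) < th < pi / 2.
  by rewrite -ltr_norml; apply: le_lt_trans zdelta _; lra.
have kap : ka * Z <= Z * cos th.
  rewrite mulrC ler_pM2l//.
  have -> : cos th = cos `|th|.
    by have [t0|t0] := leP 0 th; [rewrite ger0_norm|rewrite ltr0_norm// cosN].
  have dpi : pi / 2 - delta <= pi by have := pi_gt0 R; lra.
  move: zdelta; rewrite le_eqVlt => /predU1P[->//|thlt]; apply/ltW.
  rewrite ltr_cos// in_itv/= ?normr_ge0/= ?dpi ?andbT ?(le_trans (ltW thlt))//.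
  exact: le_trans (normr_ge0 th) (ltW thlt).
have pZ : Z * cos th <= Z by rewrite ler_piMr ?cos_le1// ltW.
have qZ : `|Z * sin th| <= Z by rewrite normrM (gtr0_norm Z0) ler_piMr ?sin1// ltW.
have [ic Ec] := Hc Z _ _ zr1 kap pZ qZ.
have [isn Es] := Hs Z _ _ zr2 kap pZ qZ.
have p0 : 0 < Z * cos th by rewrite mulr_gt0// cos_gt0_pihalf.
have mh (c : R -> R) : continuous c ->
    measurable_fun Omega (fun x => expR (- (Z * cos th * S x)) * c (Z * sin th * S x)).
  move=> cc; apply: measurable_funM.
    apply: measurableT_comp; first exact: measurable_expR.
    apply: measurableT_comp; first exact: oppr_measurable.
    by apply: measurable_funM; [exact: measurable_cst|exact: mS].
  apply: (@measurableT_comp _ _ _ _ _ _ c); first exact: continuous_measurable_fun.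
  by apply: measurable_funM; [exact: measurable_cst|exact: mS].
have [icf Icf] := transfer _ (mh cos (@continuous_cos R)) ic.
have [isf Isf] := transfer _ (mh sin (@continuous_sin R)) isn.
have [_ Bc] := damped _ (Z * sin th) cos p0 (@continuous_cos R) cos1.
have [_ Bs] := damped _ (Z * sin th) sin p0 (@continuous_sin R) sin1.
(* The model integrals become Z^(-a) cos(a th) and Z^(-a) sin(a th) times the constant: up to the
   sign of the second, the real and imaginary parts of z^(-a) times the constant. *)
rewrite -Icf Bc Rintegral_gamma_cos// in Ec.
rewrite -Isf Bs Rintegral_gamma_sin// in Es.
have ReE x : complex.Re (integrand z x) =
    expR (- (Z * cos th * S x)) * cos (Z * sin th * S x) * f x.
  rewrite /integrand; move: zRe zIm; case: (z) => p q /= -> ->.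
  by rewrite !mulr0 !subr0 !add0r !mulNr cosN.
have ImE x : complex.Im (integrand z x) =
    - (expR (- (Z * cos th * S x)) * sin (Z * sin th * S x) * f x).
  rewrite /integrand; move: zRe zIm; case: (z) => p q /= -> ->.
  by rewrite !mulr0 !subr0 !add0r !mulNr sinN mulrN mulNr.
split.
  split.
    move: icf; apply: eq_integrable => // x _; exact: (congr1 EFin (esym (ReE x))).
  move/integrableN : isf; apply: eq_integrable => // x _.
  exact: (congr1 EFin (esym (ImE x))).
have -> : cintegral lebesgue_n Omega (integrand z) =
    (\int[lebesgue_n]_(x in Omega)
       (expR (- (Z * cos th * S x)) * cos (Z * sin th * S x) * f x)) +i*
    (- \int[lebesgue_n]_(x in Omega)
       (expR (- (Z * cos th * S x)) * sin (Z * sin th * S x) * f x)).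
  rewrite /cintegral; congr (_ +i* _); first by apply: eq_Rintegral => x _; exact: ReE.
  rewrite -mulN1r -RintegralZl//.
  by apply: eq_Rintegral => x _; rewrite mulN1r; exact: ImE.
rewrite intE cpow_realE// -/Z -/th.
apply: (le_trans (normc_ReIm_le _)).
have -> : eta * Z `^ (- a) = eta / 2 * Z `^ (- a) + eta / 2 * Z `^ (- a).
  by field.
move: Ec Es; rewrite -/a -/K.
set Ic := \int[_]_(x in _) _; set Is := \int[_]_(x in _) _ => Ec Es /=.
apply: lerD.
  by move: Ec; congr (`|_| <= _); ring.
by move: Es; rewrite -normrN; congr (`|_| <= _); ring.
Qed.
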